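(* Let $\pi$ be a permutation of $\{1,\dots,n\}$, $n\ge 1$. The associated link $L_\pi$ is non-split if and only if $\pi$ is a stabilized-interval-free permutation.
   Context: The cycle diagram $G_\pi\subset\mathbb R^2$ of $\pi\in S_n$ (with $\pi_i=\pi(i)$) is the union, over all $i$ with $\pi_i\ne i$, of the vertical segment from $(i,i)$ to $(i,\pi_i)$ and the horizontal segment from $(i,\pi_i)$ to $(\pi_i,\pi_i)$, together with an isolated point $(i,i)$ for each fixed point $i$ of $\pi$. The associated link $L_\pi\subset\mathbb R^3$ is the link with planar diagram $G_\pi$, where at every crossing of a vertical segment with a horizontal segment the vertical strand passes over the horizontal strand, and each isolated point is replaced by a small circle (a square around $(i,i)$) disjoint from the rest of the diagram, representing an unlinked unknotted component. The components of $L_\pi$ correspond to the cycles of $\pi$ (including fixed points). A link $L\subset\mathbb R^3$ is split if there is a surface in $\mathbb R^3$ homeomorphic to the 2-sphere that is disjoint from $L$ and has components of $L$ in both its interior and its exterior; otherwise $L$ is non-split. A permutation $\pi$ stabilizes an interval $I\subseteq\{1,\dots,n\}$ (a set of consecutive integers) if $\pi(i)\in I$ for every $i\in I$. The permutation $\pi$ is stabilized-interval-free if it stabilizes no nontrivial (i.e. non-empty and proper) subinterval $I\subset\{1,\dots,n\}$. *)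

(* Defs.v *)
From mathcomp Require Import all_boot all_order all_algebra all_fingroup.
From mathcomp Require Import all_classical all_reals all_analysis.

Set Implicit Arguments.
Unset Strict Implicit.
Unset Printing Implicit Defensive.

Import Order.TTheory GRing.Theory Num.Theory.
Import numFieldNormedType.Exports.

Local Open Scope classical_set_scope.
Local Open Scope ring_scope.

Section StabilizedIntervals.
Variable n : nat.
Implicit Types (s : {perm 'I_n}) (I : {set 'I_n}).

Definition is_interval I : Prop :=
  exists a b : nat, I = [set i : 'I_n | (a <= i <= b)%N]%SET.

Definition stabilizes s I : Prop := forall i, i \in I -> s i \in I.

Definition stabilized_interval_free s : Prop :=
  forall I, is_interval I -> I != finset.set0 -> I \proper [set: 'I_n]%SET ->
    ~ stabilizes s I.

End StabilizedIntervals.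

Section PermutationLink.
Variables (R : realType) (n : nat).
Implicit Types (s : {perm 'I_n}) (i j : 'I_n).

(* ['I_n] is {0, ..., n-1}; the shift gives the labels 1, ..., n. *)
Definition pos i : R := i.+1%:R.

Definition segment (a b : R) : set R :=
  [set t | Num.min a b <= t <= Num.max a b].

Definition vertical_edge s i : set (R * R) :=
  [set (pos i, y) | y in segment (pos i) (pos (s i))].

Definition horizontal_edge s i : set (R * R) :=
  [set (x, pos (s i)) | x in segment (pos i) (pos (s i))].

(* The boundary of a square centred at (i, i). All edges lie on lines x = k or
   y = k with k <> i an integer, so a half-side of 1/4 keeps it away from the
   edges and from the other squares. *)
Definition fixpoint_square i : set (R * R) :=
  [set q | Num.max `|q.1 - pos i| `|q.2 - pos i| = 4^-1].

Definition point3 (x y z : R) : 'rV[R]_3 := \row_(k < 3) [:: x; y; z]`_k.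

Definition at_height (h : R * R -> R) (q : R * R) : 'rV[R]_3 :=
  point3 q.1 q.2 (h q).

(* Zero at both endpoints of the vertical edge of i and positive in between:
   lifting vertical edges to this height, and leaving horizontal edges and
   squares at height 0, yields closed curves that project injectively onto the
   diagram except at the crossings, where the vertical strand is on top
   (see [vertical_over]). *)
Definition vertical_height s i (q : R * R) : R :=
  (q.2 - pos i) * (pos (s i) - q.2).

Definition permutation_link s : set 'rV[R]_3 :=
  \bigcup_(i in [set i | s i != i])
     (at_height (vertical_height s i) @` vertical_edge s i
      `|` at_height (fun=> 0) @` horizontal_edge s i)
  `|` \bigcup_(i in [set i | s i = i]) (at_height (fun=> 0) @` fixpoint_square i).

(* A vertical and a horizontal edge share a point other than a common endpoint
   only if i <> j and s j <> i. *)
Lemma vertical_over s i j (q : R * R) :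
  i != j -> s j != i -> vertical_edge s i q -> horizontal_edge s j q ->
  0 < vertical_height s i q.
Proof.
move=> ij sji [y ybtw <-] [x _ [_ yE]]; rewrite /vertical_height /=.
move: ybtw; rewrite /segment /= -yE.
have pos_neq k l : k != l -> pos k != pos l.
  by move=> kl; rewrite /pos eqr_nat eqSS.
have /pos_neq : s j != s i by rewrite (inj_eq perm_inj) eq_sym.
have := pos_neq _ _ sji; move: (pos i) (pos (s i)) (pos (s j)) => a b c.
rewrite ge_min le_max !neq_lt.
case/orP=> [ca|ac] /orP[cb|bc].
- by rewrite !leNgt ca cb.
- by rewrite nmulr_rgt0 subr_lt0.
- by rewrite pmulr_rgt0 subr_gt0.
- by rewrite !leNgt ac bc andbF.
Qed.

End PermutationLink.

Arguments permutation_link R [n] s _.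

Section SplitLinks.
Variable R : realType.
Implicit Types (L S K : set 'rV[R]_3) (x : 'rV[R]_3).

Definition homeomorphic (T U : topologicalType) (A : set T) (B : set U) :
    Prop :=
  exists (f : T -> U) (g : U -> T),
    [/\ set_fun A B f, set_fun B A g, {in A, cancel f g}, {in B, cancel g f} &
        {within A, continuous f} /\ {within B, continuous g}].

Definition unit_sphere : set 'rV[R]_3 :=
  [set x : 'rV[R]_3 | \sum_k x ord0 k ^+ 2 = 1].

Definition is_sphere S : Prop := homeomorphic unit_sphere S.

(* The complement of a topological sphere in R^3 has exactly one bounded and
   one unbounded connected component (Jordan-Brouwer): its interior and its
   exterior. *)
Definition sphere_interior S : set 'rV[R]_3 :=
  [set x | ~ S x /\ bounded_set (connected_component (~` S) x)].

Definition sphere_exterior S : set 'rV[R]_3 :=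
  [set x | ~ S x /\ ~ bounded_set (connected_component (~` S) x)].

Definition is_component L K : Prop :=
  exists2 x, L x & K = connected_component L x.

Definition split_link L : Prop :=
  exists S, [/\ is_sphere S, S `&` L = set0,
    exists2 K, is_component L K & K `<=` sphere_interior S &
    exists2 K, is_component L K & K `<=` sphere_exterior S].

Definition nonsplit_link L : Prop := ~ split_link L.

End SplitLinks.

(* Main.v *)
Require Import Defs.
From mathcomp Require Import all_boot all_order all_algebra all_fingroup.
From mathcomp Require Import all_classical all_reals all_analysis.
From mathcomp Require Import ring lra zify.

(** The link splits along a stabilized interval, and linking numbers keep it together otherwise.

If an interval [I] is stabilized, every strand with label outside [I] runs in a row or a
column outside [I], while the strands with labels in [I] stay over the square spanned by
[I]. Hence the surface of a box over that square, slightly enlarged, separates them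
([stabilized_interval_split]).

Conversely let a topological sphere [S] split the link, and let [J] be the set of labels
whose strands lie in the interior of [S]; it is a union of cycles of [s]. The heart of the
proof is [no_crossing]: no vertical edge of a strand on one side of [S] passes over a
horizontal edge of a strand on the other side. The permutation then stabilizes an interval,
by an elementary argument on the extreme labels of [J] ([noncrossing_stabilized_interval]).

The reason for [no_crossing] is that all crossings of the diagram contribute with the same
sign to linking numbers: above the diagonal vertical edges go up and horizontal ones go
right, below it they go down and left. Two unions of cycles which cross therefore have a
nonzero linking number, which a separating sphere forbids. Instead of homology, the proof
uses functions with values in the circle R/Z, represented by real functions that are
continuous modulo the integers ([zcont]). Off the strands of [J] there is such a function,
[winding], which turns once around each strand. Its restriction to [S] lifts to a continuous
real function, because the sphere is simply connected ([sphere_lift]); extend that lift to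
the whole space by Tietze's theorem and use it in place of [winding] on the side of [J]. The
result is a circle-valued function on all of R^3 ([separated_extension]), which again lifts.
So [winding] has a continuous real lift [H] on the other side of [S] ([separated_lift]), and
the increments of [H] along a closed curve on that side add up to 0.

It remains to compute these increments along the strands outside [J]. The strand of [i] and
a chord of the diagonal bound a triangle with vertices (i,i), (i,s i) and (s i,s i). Over a
generic point of the diagonal as many [i] in [J] go up as go down ([sum_dir_spans]), so the
chords cancel and the strands of [J] are the sum of the boundaries of these triangles,
lifted to space along a [roof]. Accordingly [winding] is the sum of the angles of the pairs
([depth], [elevation]), where [depth] tells the inside of the triangle from its outside and
[elevation] is the height above the roof. A vertical edge outside [J] never runs below a
roof and a horizontal one never above. There the angle is, modulo the integers, 1/4 - c/4
and c/4 - 1/4 respectively, where [c] is the cosine of the angle, and the sum [balance] of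
these cosines is an honest continuous function. So 4 H + balance is constant on vertical
edges and 4 H - balance is constant on horizontal ones. Adding up over all strands outside
[J] leaves: the drops of [balance] from the end of each horizontal edge to its beginning
have sum 0 ([sum_balance_drop]). By [balance_drop] such a drop is twice the number of
strands of [J] that cross over the edge, hence there are none. *)

Set Implicit Arguments.
Unset Strict Implicit.
Unset Printing Implicit Defensive.

Import Order.TTheory GRing.Theory Num.Theory.
Import numFieldNormedType.Exports.

Local Open Scope classical_set_scope.
Local Open Scope ring_scope.

(** * Real functions that are continuous modulo the integers *)

Section ModZ.
Variable R : realType.

Definition is_integer (x : R) : Prop := exists k : int, x = k%:~R.

Lemma is_integer0 : is_integer 0. Proof. by exists 0. Qed.

Lemma is_integerD x y : is_integer x -> is_integer y -> is_integer (x + y).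
Proof. by move=> [k ->] [l ->]; exists (k + l); rewrite intrD. Qed.

Lemma is_integerN x : is_integer x -> is_integer (- x).
Proof. by move=> [k ->]; exists (- k); rewrite mulrNz. Qed.

Lemma is_integerB x y : is_integer x -> is_integer y -> is_integer (x - y).
Proof. by move=> xZ yZ; apply/is_integerD/is_integerN. Qed.

Lemma is_integer_sum (I : Type) (r : seq I) (P : pred I) (f : I -> R) :
  (forall i, P i -> is_integer (f i)) -> is_integer (\sum_(i <- r | P i) f i).
Proof. by move=> fZ; elim/big_ind : _ => //; [exact: is_integer0|exact: is_integerD]. Qed.

(** Convergence in the circle R/Z, for functions given by arbitrary real representatives. *)
Definition zlim (T : Type) (W : set_system T) (F : T -> R) (l : R) : Prop :=
  forall e, 0 < e -> \forall q \near W, exists2 k, is_integer k & `|F q - l - k| < e.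

Definition zcont (T : topologicalType) (K : set T) (F : T -> R) : Prop :=
  forall p, K p -> zlim (within K (nbhs p)) F (F p).

Section Zlim.
Variables (T : Type) (W : set_system T).
Context {FW : Filter W}.

Lemma cvg_zlim (F : T -> R) l : F @ W --> l -> zlim W F l.
Proof.
move=> /cvgrPdist_lt Fl e e0; apply: filterS (Fl e e0) => q qe.
by exists 0; [exact: is_integer0|rewrite subr0 distrC].
Qed.

Lemma zlimD (F G : T -> R) l m :
  zlim W F l -> zlim W G m -> zlim W (fun q => F q + G q) (l + m).
Proof.
move=> Fl Gm e e0; have e20 : 0 < e / 2 by lra.
have := Gm _ e20; have := Fl _ e20; apply: filterS2 => q [k kZ Fk] [k' k'Z Gk].
exists (k + k'); first exact: is_integerD.
have -> : F q + G q - (l + m) - (k + k') = (F q - l - k) + (G q - m - k') by lra.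
rewrite (le_lt_trans (ler_normD _ _))//; lra.
Qed.

Lemma zlimN (F : T -> R) l : zlim W F l -> zlim W (fun q => - F q) (- l).
Proof.
move=> Fl e e0; have := Fl _ e0; apply: filterS => q [k kZ Fk].
exists (- k); first exact: is_integerN.
by rewrite -normrN; have -> : - (- F q - - l - - k) = F q - l - k by lra.
Qed.

Lemma zlim_sum (I : Type) (r : seq I) (P : pred I) (F : I -> T -> R) (l : I -> R) :
  (forall i, P i -> zlim W (F i) (l i)) ->
  zlim W (fun q => \sum_(i <- r | P i) F i q) (\sum_(i <- r | P i) l i).
Proof.
move=> Fl; elim: r => [|i r IHr].
  move=> e e0; apply: nearW => q; exists 0; first exact: is_integer0.
  by rewrite !big_nil !subr0 normr0.
rewrite (_ : (fun q => _) = fun q => (if P i then F i q else 0) +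
    \sum_(j <- r | P j) F j q); last first.
  by apply/funext => q; rewrite big_cons; case: (P i) => //; rewrite add0r.
have -> : \sum_(j <- (i :: r) | P j) l j =
    (if P i then l i else 0) + \sum_(j <- r | P j) l j.
  by rewrite big_cons; case: (P i) => //; rewrite add0r.
apply: zlimD => //; case: (boolP (P i)) => [/Fl//|_].
by apply: cvg_zlim; exact: cvg_cst.
Qed.

Lemma zlim_near (F G : T -> R) l m :
  (\forall q \near W, is_integer (F q - G q)) -> is_integer (l - m) ->
  zlim W G m -> zlim W F l.
Proof.
move=> FG lm Gm e e0; have := Gm _ e0; have := FG.
apply: filterS2 => q FGq [k kZ Gk]; exists (k + (F q - G q) - (l - m)).
  by apply: is_integerB => //; exact: is_integerD.
have -> // : F q - l - (k + (F q - G q) - (l - m)) = G q - m - k by lra.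
Qed.

(** The representative modulo 1 in the interval from -1/2 to 1/2; it is continuous on R/Z away
    from the class of 1/2, which is why lifts can be built from short steps. *)
Definition residue (t : R) : R := t - (Num.floor (t + 2^-1))%:~R.

Lemma residueE k t : is_integer k -> `|t| < 2^-1 -> residue (k + t) = t.
Proof.
move=> [m ->] t2; rewrite /residue (_ : Num.floor _ = m); first lra.
by apply: floor_def; rewrite intrD; move: t2; rewrite ltr_norml => /andP[? ?]; lra.
Qed.

Lemma residue_cvg (F : T -> R) l k : is_integer k -> `|l - k| < 4^-1 ->
  zlim W F l -> (residue \o F) @ W --> residue l.
Proof.
move=> kZ lk Fl; apply/cvgrPdist_lt => e e0.
have e'0 : 0 < Num.min e (4^-1) by rewrite lt_min e0/=; lra.
have := Fl _ e'0; apply: filterS => q [m mZ]; rewrite lt_min => /andP[Fe F4] /=.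
have -> : residue l = l - k.
  by rewrite -[in LHS](subrKC k l) residueE//; lra.
have -> : F q = (k + m) + ((l - k) + (F q - l - m)) by lra.
rewrite residueE; [|exact: is_integerD|].
  by rewrite -normrN; congr (_ < _) : Fe; congr (`|_|); lra.
rewrite (le_lt_trans (ler_normD _ _))//; lra.
Qed.

End Zlim.

Lemma zlim_le (T : Type) (W W' : set_system T) (F : T -> R) l :
  W `=>` W' -> zlim W' F l -> zlim W F l.
Proof. by move=> WW' Fl e e0; apply: WW'; exact: Fl. Qed.

Lemma zcontW (T : topologicalType) (K K' : set T) (F : T -> R) :
  K `<=` K' -> zcont K' F -> zcont K F.
Proof.
move=> KK' cF p Kp e e0; have pF : \forall q \near nbhs p, K' q -> _ :=
  cF p (KK' _ Kp) e e0.
have : \forall q \near nbhs p, K q -> exists2 k, is_integer k & `|F q - F p - k| < e.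
  by apply: filterS pF => q Fq /KK'.
exact.
Qed.

Lemma zcontT (T : topologicalType) (F : T -> R) :
  (forall p, zlim (nbhs p) F (F p)) -> zcont setT F.
Proof.
by move=> cF p _; apply: zlim_le (cF p) => D; rewrite /within /=; apply: filterS => q.
Qed.

Lemma zcont_comp (T U : topologicalType) (A : set T) (B : set U) (f : T -> U)
    (F : U -> R) :
  set_fun A B f -> {within A, continuous f} -> zcont B F -> zcont A (F \o f).
Proof.
move=> AB /subspace_continuousP cf cF p Ap e e0 /=.
have fB : \forall q \near nbhs p, A q -> B (f q) -> _ :=
  cf p Ap _ (cF (f p) (AB _ Ap) e e0).
by apply: filterS fB => q /= Bq Aq; exact: Bq Aq (AB _ Aq).
Qed.

(** The Heine-Cantor theorem for functions with values in the circle. *)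
Lemma zcont_uniform (V : normedModType R) (K : set V) (F : V -> R) e :
  0 < e -> compact K -> zcont K F ->
  exists2 d, 0 < d & forall p q, K p -> K q -> `|p - q| < d ->
    exists2 k, is_integer k & `|F q - F p - k| < e.
Proof.
move=> e0 /compact_near_coveringP Kc cF.
pose P (d : R) p := K p -> forall q, K q -> `|p - q| < d ->
  exists2 k, is_integer k & `|F q - F p - k| < e.
have := Kc R (0^'+) P _; case => [|d /= d0 dP].
  move=> x Kx; have e20 : 0 < e / 2 by lra.
  have /nbhs_ballP[r /= r0 xr] := cF x Kx _ e20.
  exists (ball x (r / 2), [set d | d < r / 2]) => /=.
    split; first by apply: nbhsx_ballx; lra.
    by apply: nbhs_right_lt; lra.
  move=> [p d] /= [xp dr] Kp q Kq pq.
  have xp' : ball x r p by apply: le_ball xp; lra.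
  have xq : ball x r q.
    have -> : r = r / 2 + r / 2 by lra.
    by apply: ball_triangle xp _; rewrite -ball_normE /=; lra.
  have [k kZ Fp] := xr _ xp' Kp; have [l lZ Fq] := xr _ xq Kq.
  exists (l - k); first exact: is_integerB.
  have -> : F q - F p - (l - k) = (F q - F x - l) - (F p - F x - k) by lra.
  rewrite (le_lt_trans (ler_normB _ _))//; lra.
have d20 : 0 < d / 2 by lra.
exists (d / 2) => // p q Kp.
apply: (dP (d / 2)) => //=.
by rewrite sub0r normrN gtr0_norm//; lra.
Qed.

(** A circle-valued function lifts along each ray from the origin. Uniform continuity allows
    to do it with the same finite number of steps for all rays, so the lift is a finite sum of
    residues of increments and its continuity is immediate. *)
Lemma zcont_lift (V : normedModType R) (K : set V) (F : V -> R) :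
  compact K -> (forall t x, 0 <= t <= 1 -> K x -> K (t *: x)) -> zcont K F ->
  exists2 G : V -> R, {within K, continuous G} &
    forall x, K x -> is_integer (F x - G x).
Proof.
move=> Kc Kstar cF.
have e0 : 0 < 4^-1 :> R by lra.
have [d d0 unif] := zcont_uniform e0 Kc cF.
have [M M0 KM] : exists2 M, 0 < M & forall x, K x -> `|x| <= M.
  have [M [Mr MK]] := compact_bounded Kc.
  exists (`|M| + 1) => [|x Kx]; first by rewrite ltr_wpDl.
  by apply: MK => //; rewrite (le_lt_trans (ler_norm _))// ltrDl.
have [N N0 MN] : exists2 N : nat, (0 < N)%N & M / N%:R < d.
  exists (Num.truncn (M / d)).+1 => //.
  rewrite ltr_pdivrMr// mulrC -ltr_pdivrMr//.
  exact: truncnS_gt.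
have N0' : 0 < N%:R :> R by rewrite ltr0n.
pose c (k : nat) : R := k%:R / N%:R.
have c01 k : (k <= N)%N -> 0 <= c k <= 1.
  by move=> kN; rewrite /c divr_ge0//= ler_pdivrMr// mul1r ler_nat.
(* The increments of F along the ray through x, each less than 1/4 modulo the integers. *)
pose D k x := F (c k.+1 *: x) - F (c k *: x).
pose G x := F 0 + \sum_(k < N) residue (D k x).
have Dint k x : K x -> (k < N)%N -> exists2 m, is_integer m & `|D k x - m| < 4^-1.
  move=> Kx kN; apply: unif; [exact: Kstar (c01 _ (ltnW kN)) Kx|
    exact: Kstar (c01 _ kN) Kx|].
  rewrite -scalerBl normrZ (_ : _ - _ = - N%:R^-1); last first.
    rewrite /c -mulrBl -natr1; field; lra.
  rewrite normrN gtr0_norm ?invr_gt0// mulrC (le_lt_trans _ MN)//.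
  by rewrite ler_pM2r ?invr_gt0// KM.
have Zcont k : (k <= N)%N -> zcont K (fun x => F (c k *: x)).
  move=> kN; apply: (zcont_comp (B := K) (f := fun x => c k *: x)) cF.
    by move=> x; apply: Kstar; exact: c01.
  apply: continuous_subspaceT; exact: scaler_continuous.
exists G.
  apply/subspace_continuousP => p Kp; apply: cvgD; first exact: cvg_cst.
  apply: cvg_big => [|k _]; first exact: add_continuous.
  have [m mZ Dm] := Dint k p Kp (ltn_ord k).
  apply: residue_cvg mZ Dm _.
  apply: zlimD; first exact: Zcont.
  by apply: zlimN; apply: Zcont => //; exact: ltnW.
move=> x Kx; rewrite /G.
have -> : F x = F 0 + \sum_(k < N) D k x.
  rewrite -(big_mkord xpredT (D ^~ x)) (telescope_sumr_eq (fun k => F (c k *: x)))//.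
  rewrite /c divff ?gt_eqF// mul0r scale0r scale1r; lra.
rewrite opprD addrACA subrr add0r -sumrB; apply: is_integer_sum => k _.
by rewrite /residue opprB addrC subrK; eexists.
Qed.

End ModZ.

(** * Continuity of real functions and curves in space *)

Section Space.
Variable R : realType.
Local Notation V := 'rV[R]_3.

Lemma cvg_sumr (T : Type) (W : set_system T) {FW : Filter W} (I : Type) (r : seq I)
    (P : pred I) (f : I -> T -> R) (l : I -> R) :
  (forall i, P i -> f i @ W --> l i) ->
  (fun x => \sum_(i <- r | P i) f i x) @ W --> \sum_(i <- r | P i) l i.
Proof. by move=> fl; apply: cvg_big => //; exact: add_continuous. Qed.

Lemma continuous_within_comp (T U W : topologicalType) (A : set T) (B : set U)
    (f : T -> U) (g : U -> W) :
  set_fun A B f -> {within A, continuous f} -> {within B, continuous g} ->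
  {within A, continuous (g \o f)}.
Proof.
move=> AB /subspace_continuousP cf /subspace_continuousP cg.
apply/subspace_continuousP => p Ap D /(cg _ (AB _ Ap)) gD.
have : \forall q \near nbhs p, A q -> B (f q) -> D (g (f q)) := cf p Ap _ gD.
by apply: filterS => q /= Bq Aq; exact: Bq Aq (AB _ Aq).
Qed.

Lemma sum3 (f : 'I_3 -> R) : \sum_k f k = f 0 + f 1 + f 2%:R.
Proof.
by rewrite !big_ord_recl big_ord0 addr0 addrA; congr (f _ + f _ + f _); exact/val_inj.
Qed.

Lemma ord3P (P : 'I_3 -> Prop) : P 0 -> P 1 -> P 2%:R -> forall k, P k.
Proof.
move=> P0 P1 P2 [[|[|[|//]]] k3].
- by rewrite (_ : Ordinal _ = 0) //; exact/val_inj.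
- by rewrite (_ : Ordinal _ = 1) //; exact/val_inj.
- by rewrite (_ : Ordinal _ = 2%:R) //; exact/val_inj.
Qed.

Lemma point3E (x y z : R) :
  (point3 x y z ord0 0 = x) * (point3 x y z ord0 1 = y) * (point3 x y z ord0 2%:R = z).
Proof. by rewrite !mxE. Qed.

Lemma point3_eta (v : V) : point3 (v ord0 0) (v ord0 1) (v ord0 2%:R) = v.
Proof. by apply/rowP; apply: ord3P; rewrite point3E. Qed.

Lemma coord_le_norm (v : V) k : `|v ord0 k| <= `|v|.
Proof.
rewrite /Num.norm/= mx_normrE; apply: (le_bigmax _ (fun ij => `|v ij.1 ij.2|) (ord0, k)).
Qed.

Lemma norm3_lt (v : V) e : 0 < e -> (forall k, `|v ord0 k| < e) -> `|v| < e.
Proof.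
move=> e0 ve; rewrite /Num.norm/= mx_normrE; apply/bigmax_ltP; split=> // -[i j] _ /=.
by rewrite ord1.
Qed.

Lemma norm3_le (v : V) e : 0 <= e -> (forall k, `|v ord0 k| <= e) -> `|v| <= e.
Proof.
move=> e0 ve; rewrite /Num.norm/= mx_normrE; apply/bigmax_leP; split=> // -[i j] _ /=.
by rewrite ord1.
Qed.

Lemma point3_cvg (T : Type) (W : set_system T) {FW : Filter W} (f g h : T -> R) a b c :
  f @ W --> a -> g @ W --> b -> h @ W --> c ->
  (fun t => point3 (f t) (g t) (h t)) @ W --> point3 a b c.
Proof.
move=> /cvgrPdist_lt fa /cvgrPdist_lt gb /cvgrPdist_lt hc.
apply/cvgrPdist_lt => e e0.
have := hc e e0; have := gb e e0; have := fa e e0; apply: filterS3 => t ft gt ht.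
by apply: norm3_lt => //; apply: ord3P; rewrite !mxE/=.
Qed.

Lemma point3_continuous (T : topologicalType) (f g h : T -> R) :
  continuous f -> continuous g -> continuous h ->
  continuous (fun t => point3 (f t) (g t) (h t)).
Proof. by move=> cf cg ch t; apply: point3_cvg; [exact: cf|exact: cg|exact: ch]. Qed.

Lemma continuous_sumr (T : topologicalType) (I : Type) (r : seq I)
    (P : pred I) (f : I -> T -> R) :
  (forall i, P i -> continuous (f i)) -> continuous (fun x => \sum_(i <- r | P i) f i x).
Proof. by move=> cf x; apply: cvg_sumr => i Pi; exact: cf. Qed.

Section ContinuousReal.
Variable T : topologicalType.
Implicit Types f g : T -> R.

(** Continuity of real functions on an arbitrary topological space, in the pointwise form that
    applies to explicit formulas. *)
Lemma cts_cst (c : R) : continuous (fun _ : T => c).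
Proof. exact: cst_continuous. Qed.

Lemma cts_add f g : continuous f -> continuous g -> continuous (fun x => f x + g x).
Proof. by move=> cf cg x; apply: cvgD; [exact: cf|exact: cg]. Qed.

Lemma cts_opp f : continuous f -> continuous (fun x => - f x).
Proof. by move=> cf x; apply: cvgN; exact: cf. Qed.

Lemma cts_mul f g : continuous f -> continuous g -> continuous (fun x => f x * g x).
Proof. by move=> cf cg x; apply: cvgM; [exact: cf|exact: cg]. Qed.

Lemma cts_exp f n : continuous f -> continuous (fun x => f x ^+ n).
Proof.
by move=> cf x; apply: (@continuous_comp _ _ _ f (fun y : R => y ^+ n));
  [exact: cf|exact: exprn_continuous].
Qed.

Lemma cts_sqrt f : continuous f -> continuous (fun x => Num.sqrt (f x)).
Proof.
by move=> cf x; apply: (@continuous_comp _ _ _ f Num.sqrt);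
  [exact: cf|exact: sqrt_continuous].
Qed.

Lemma cts_norm f : continuous f -> continuous (fun x => `|f x|).
Proof. by move=> cf x; apply: cvg_norm; exact: cf. Qed.

Lemma cts_max f g : continuous f -> continuous g -> continuous (fun x => Num.max (f x) (g x)).
Proof.
move=> cf cg; rewrite (_ : (fun x => _) = fun x => 2^-1 * (f x + g x + `|f x - g x|)).
  apply: cts_mul; [exact: cts_cst|apply: cts_add; first exact: cts_add].
  by apply: cts_norm; apply: cts_add => //; exact: cts_opp.
by apply/funext => x; rewrite maxr_absE mulrC.
Qed.

Lemma cts_min f g : continuous f -> continuous g -> continuous (fun x => Num.min (f x) (g x)).
Proof.
move=> cf cg; rewrite (_ : (fun x => _) = fun x => - Num.max (- f x) (- g x)).
  by apply: cts_opp; apply: cts_max; exact: cts_opp.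
by apply/funext => x; rewrite oppr_max !opprK.
Qed.

End ContinuousReal.

Lemma cts_id : continuous (fun x : R => x).
Proof. by move=> x; exact: cvg_id. Qed.

Lemma cts_coord k : continuous (fun v : V => v ord0 k).
Proof. exact: coord_continuous. Qed.

(** Otherwise the intermediate value theorem would give a value at distance 1/2 from [f a]. *)
Lemma integer_path_const (f : R -> R) a b : a <= b ->
  {within `[a, b], continuous f} ->
  (forall t, a <= t <= b -> is_integer (f t - f a)) -> f b = f a.
Proof.
move=> ab cf fZ; have [k kE] : is_integer (f b - f a) by apply: fZ; rewrite ab lexx.
have nohalf v : f a < v < f a + 1 \/ f a - 1 < v < f a ->
    ~ Num.min (f a) (f b) <= v <= Num.max (f a) (f b).
  move=> vE vab; have [c] := IVT ab cf vab; rewrite in_itv/= => /fZ[m mE] cv.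
  move: vE; rewrite -cv; have -> : f c = f a + m%:~R by lra.
  have [m0|m0|->] := ltgtP m 0; last lra.
  - have : (m%:~R : R) <= (-1)%:~R by rewrite ler_int; lia.
    by rewrite mulrNz; lra.
  - have : (1%:~R : R) <= m%:~R by rewrite ler_int; lia.
    lra.
have [k0|k0|k0] := ltgtP k 0; last by move: kE; rewrite k0; lra.
- have : (k%:~R : R) <= (-1)%:~R by rewrite ler_int; lia.
  rewrite mulrNz => k1; exfalso; apply: (nohalf (f a - 2^-1)); first by right; lra.
  by rewrite ge_min le_max; lra.
- have : (1%:~R : R) <= k%:~R by rewrite ler_int; lia.
  move=> k1; exfalso; apply: (nohalf (f a + 2^-1)); first by left; lra.
  by rewrite ge_min le_max; lra.
Qed.

End Space.

(** * Lifting through the circle on the round sphere *)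

Section Sphere.
Variable R : realType.
Local Notation V := 'rV[R]_3.

(** For [e] = 1 or -1, the projection of the unit ball to the upper or lower hemisphere along
    the vertical axis. It makes a hemisphere a retract of the ball, which is star-shaped. *)
Definition hemisphere_graph (e : R) (v : V) : V :=
  point3 (v ord0 0) (v ord0 1) (e * Num.sqrt (1 - (v ord0 0 ^+ 2 + v ord0 1 ^+ 2))).

Definition unit_ball : set V := [set v | \sum_k v ord0 k ^+ 2 <= 1].

Lemma hemisphere_graph_continuous e : continuous (hemisphere_graph e).
Proof.
apply: point3_continuous; try exact: cts_coord.
apply: cts_mul; [exact: cts_cst|apply: cts_sqrt; apply: cts_add; first exact: cts_cst].
by apply: cts_opp; apply: cts_add; apply: cts_exp; exact: cts_coord.
Qed.

Lemma hemisphere_graph_sphere e v : e ^+ 2 = 1 -> unit_ball v ->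
  unit_sphere (hemisphere_graph e v).
Proof.
move=> e1; rewrite /unit_ball /unit_sphere /= !sum3 !point3E => v1.
have := sqr_ge0 (v ord0 2%:R) => v2.
rewrite exprMn e1 sqr_sqrtr; lra.
Qed.

Lemma hemisphere_graph_id e v : e ^+ 2 = 1 -> unit_sphere v ->
  0 <= e * v ord0 2%:R -> hemisphere_graph e v = v.
Proof.
move=> e1; rewrite /unit_sphere /= sum3 => v1 ev.
rewrite -[RHS]point3_eta /hemisphere_graph; congr point3.
have -> : 1 - (v ord0 0 ^+ 2 + v ord0 1 ^+ 2) = (e * v ord0 2%:R) ^+ 2.
  by rewrite exprMn e1; lra.
by rewrite sqrtr_sqr ger0_norm// mulrA -expr2 e1 mul1r.
Qed.

Lemma sumsq_continuous : continuous (fun v : V => \sum_k v ord0 k ^+ 2).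
Proof.
by apply: continuous_sumr => k _; apply: cts_exp; exact: cts_coord.
Qed.

Lemma unit_ball_compact : compact unit_ball.
Proof.
apply: bounded_closed_compact.
  exists 1; split; first exact: real1.
  move=> M M1 v v1 /=; apply: norm3_le; first lra.
  move=> k; rewrite (@le_trans _ _ 1)//; last lra.
  rewrite -(expr_le1 (isT : (0 < 2)%N) (normr_ge0 _)).
  rewrite real_normK ?num_real//; apply: le_trans v1.
  by rewrite (bigD1 k)//= lerDl sumr_ge0// => i _; exact: sqr_ge0.
have -> : unit_ball = (fun v : V => \sum_k v ord0 k ^+ 2) @^-1` [set x | x <= 1] by [].
by apply: closed_comp => [v _|]; [exact: sumsq_continuous|exact: closed_le].
Qed.

Lemma unit_sphere_closed : closed (@unit_sphere R).
Proof.
have -> : @unit_sphere R = (fun v : V => \sum_k v ord0 k ^+ 2) @^-1` [set 1].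
  by apply/seteqP; split.
by apply: closed_comp => [v _|]; [exact: sumsq_continuous|exact: closed_eq].
Qed.

Lemma unit_sphere_compact : compact (@unit_sphere R).
Proof.
apply: subclosed_compact unit_sphere_closed unit_ball_compact _ => v.
by rewrite /unit_sphere /unit_ball /= => ->.
Qed.

Lemma hemisphere_lift (e : R) (F : V -> R) : e ^+ 2 = 1 -> zcont (@unit_sphere R) F ->
  exists2 G : V -> R, {within unit_ball, continuous G} &
    forall v, unit_sphere v -> 0 <= e * v ord0 2%:R -> is_integer (F v - G v).
Proof.
move=> e1 cF.
have cFh : zcont unit_ball (F \o hemisphere_graph e).
  apply: zcont_comp cF; first by move=> v; exact: hemisphere_graph_sphere.
  exact/continuous_subspaceT/hemisphere_graph_continuous.
have [t x|G cG FG] := zcont_lift unit_ball_compact _ cFh.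
  move=> /andP[t0 t1]; rewrite /unit_ball/= => x1.
  rewrite (eq_bigr (fun k => t ^+ 2 * x ord0 k ^+ 2)); last first.
    by move=> k _; rewrite !mxE exprMn.
  rewrite -mulr_sumr; apply: mulr_ile1 => //; first exact: sqr_ge0.
    by apply: sumr_ge0 => k _; exact: sqr_ge0.
  by rewrite expr_le1.
exists G => // v v1 ev; have := FG v; rewrite /= hemisphere_graph_id//; apply.
by move: v1; rewrite /unit_sphere /unit_ball /= => ->.
Qed.

(** Each point of the equator is joined to (1,0,0) by a half circle, on which an integer-
    valued continuous function is constant. *)
Lemma equator_integer_const (G : V -> R) : {within unit_ball, continuous G} ->
  (forall v, unit_sphere v -> v ord0 2%:R = 0 -> is_integer (G v)) ->
  forall v, unit_sphere v -> v ord0 2%:R = 0 -> G v = G (point3 1 0 0).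
Proof.
move=> cG GZ v v1 v2.
(* The sign e selects the half of the equator on which v lies. *)
pose e : R := if 0 <= v ord0 1 then 1 else -1.
pose f (t : R) := point3 t (e * Num.sqrt (1 - t ^+ 2)) 0.
have e1 : e ^+ 2 = 1 by rewrite /e; case: ifP; rewrite ?sqrrN expr1n.
have v01 : v ord0 0 ^+ 2 + v ord0 1 ^+ 2 = 1.
  by move: v1; rewrite /unit_sphere /= sum3 v2 expr0n addr0.
have fv : f (v ord0 0) = v.
  rewrite -[RHS]point3_eta v2 /f; congr point3.
  have -> : 1 - v ord0 0 ^+ 2 = v ord0 1 ^+ 2 by lra.
  rewrite sqrtr_sqr /e; case: ifPn => v10; first by rewrite mul1r ger0_norm.
  by rewrite ltr0_norm ?mulN1r ?opprK// ltNge.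
have f1 : f 1 = point3 1 0 0 by rewrite /f expr1n subrr sqrtr0 mulr0.
have fsph t : -1 <= t <= 1 -> unit_sphere (f t).
  move=> /andP[t0 t1]; rewrite /unit_sphere /= sum3 !point3E expr0n addr0.
  by rewrite exprMn e1 mul1r sqr_sqrtr; [lra|nra].
have v0 : -1 <= v ord0 0 <= 1 by have := sqr_ge0 (v ord0 1); nra.
have tv t : v ord0 0 <= t <= 1 -> -1 <= t <= 1 by lra.
rewrite -f1 -[in LHS]fv; apply/esym.
apply: (@integer_path_const _ (G \o f)); first by case/andP: v0.
  apply: (continuous_within_comp (f := f) (B := unit_ball) _ _ cG).
    move=> t /=; rewrite in_itv /= => /tv/fsph.
    by rewrite /unit_sphere /unit_ball /= => ->.
  apply: continuous_subspaceT.
  apply: point3_continuous; [exact: cts_id| |exact: cts_cst].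
  apply: cts_mul; [exact: cts_cst|apply: cts_sqrt; apply: cts_add; first exact: cts_cst].
  by apply: cts_opp; apply: cts_exp; exact: cts_id.
move=> t /tv tt; apply: is_integerB; apply: GZ; rewrite ?point3E//; exact: fsph.
Qed.

(** Lifts on the two hemispheres differ by an integer-valued function on the equator. The
    equator is connected, so a shift of one lift by a constant makes them agree. *)
Lemma sphere_lift (F : V -> R) : zcont (@unit_sphere R) F ->
  exists2 G : V -> R, {within (@unit_sphere R), continuous G} &
    forall v, unit_sphere v -> is_integer (F v - G v).
Proof.
move=> cF.
have [G1 cG1 FG1] := hemisphere_lift (expr1n _ 2) cF.
have [G2 cG2 FG2] : exists2 G : V -> R, {within unit_ball, continuous G} &
    forall v, unit_sphere v -> 0 <= -1 * v ord0 2%:R -> is_integer (F v - G v).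
  by apply: hemisphere_lift cF; rewrite sqrrN expr1n.
have sub : @unit_sphere R `<=` unit_ball.
  by move=> v; rewrite /unit_sphere /unit_ball /= => ->.
pose c := G1 (point3 1 0 0) - G2 (point3 1 0 0).
have eqc v : unit_sphere v -> v ord0 2%:R = 0 -> G1 v = G2 v + c.
  move=> v1 v2; suff : G1 v - G2 v = c by lra.
  apply: (@equator_integer_const (fun v => G1 v - G2 v)) => //.
    apply/subspace_continuousP => x Bx; apply: cvgB.
      by move/subspace_continuousP : cG1; exact.
    by move/subspace_continuousP : cG2; exact.
  move=> w w1 w2; have -> : G1 w - G2 w = (F w - G2 w) - (F w - G1 w) by lra.
  by apply: is_integerB; [apply: FG2|apply: FG1]; rewrite ?w2 ?mulr0.
have cZ : is_integer c.
  have w1 : unit_sphere (point3 1 0 0 : V).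
    by rewrite /unit_sphere /= sum3 !point3E expr1n !expr0n !addr0.
  have w2 : point3 1 0 0 ord0 2%:R = 0 :> R by rewrite point3E.
  have -> : c = (F (point3 1 0 0) - G2 (point3 1 0 0)) -
     (F (point3 1 0 0) - G1 (point3 1 0 0)) by rewrite /c; lra.
  by apply: is_integerB; [apply: FG2|apply: FG1]; rewrite ?w2 ?mulr0.
pose G (v : V) := if 0 <= v ord0 2%:R then G1 v else G2 v + c.
pose up := @unit_sphere R `&` [set v : V | 0 <= v ord0 2%:R].
pose down := @unit_sphere R `&` [set v : V | v ord0 2%:R <= 0].
exists G.
  have -> : @unit_sphere R = up `|` down.
    rewrite -setIUr; apply/seteqP; split=> [v v1|v []//]; split => //=.
    by case: (leP 0 (v ord0 2%:R)) => h; [left|right; exact: ltW].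
  have cl (A : set R) : closed A -> closed (@unit_sphere R `&` [set v : V | A (v ord0 2%:R)]).
    move=> Acl; apply: closedI; first exact: unit_sphere_closed.
    apply: (@closed_comp _ _ (fun v : V => v ord0 2%:R)) Acl => v _.
    exact: coord_continuous.
  apply: withinU_continuous; [exact: cl (@closed_ge _ 0)|exact: cl (@closed_le _ 0)| |].
    apply: (@subspace_eq_continuous _ _ _ G1).
      by move=> v /set_mem[_ /= v2]; rewrite /from_subspace /G v2.
    by apply: continuous_subspaceW cG1 => v [/sub].
  apply: (@subspace_eq_continuous _ _ _ (fun v => G2 v + c)).
    move=> v /set_mem[v1 /= v2]; rewrite /from_subspace /G; case: ifPn => // v2'.
    by rewrite eqc//; apply/eqP; rewrite eq_le v2.
  apply: (@continuous_subspaceW _ _ _ unit_ball); first by move=> v [/sub].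
  apply/subspace_continuousP => x Bx; apply: cvgD; last exact: cvg_cst.
  by move/subspace_continuousP : cG2; exact.
move=> v v1; rewrite /G; case: ifPn => v2; first by apply: FG1; rewrite ?mul1r.
have -> : F v - (G2 v + c) = F v - G2 v - c by lra.
apply: is_integerB => //; apply: FG2 => //.
by rewrite mulN1r oppr_ge0 ltW// ltNge.
Qed.

End Sphere.

(** * Lifting across a topological sphere *)

Section Separation.
Variable R : realType.
Local Notation V := 'rV[R]_3.

Lemma is_sphere_compact (S : set V) : is_sphere S -> compact S.
Proof.
move=> [f [g [fS gS _ gK [cf _]]]].
have -> : S = f @` (@unit_sphere R).
  apply/seteqP; split=> [x Sx|_ [y y1 <-]]; last exact: fS.
  by exists (g x); [exact: gS|apply: gK; rewrite inE].
exact: continuous_compact cf (@unit_sphere_compact R).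
Qed.

Lemma is_sphere_closed (S : set V) : is_sphere S -> closed S.
Proof. by move/is_sphere_compact; apply: compact_closed; exact: norm_hausdorff. Qed.

(** Transport to the round sphere, lift there, and extend the lift by Tietze's theorem. *)
Lemma topological_sphere_lift (S : set V) (F : V -> R) : is_sphere S -> zcont S F ->
  exists2 G : V -> R, continuous G & forall x, S x -> is_integer (F x - G x).
Proof.
move=> Ssph cF; have [f [g [fS gS _ gK [cf cg]]]] := Ssph.
have [H cH FH] := sphere_lift (zcont_comp fS cf cF).
have cHg : {within S, continuous (H \o g)} by exact: continuous_within_comp gS cg cH.
have [M M0 HM] : exists2 M, 0 < M & forall x, S x -> `|(H \o g) x| <= M.
  have [M [_ MH]] := compact_bounded (continuous_compact cHg (is_sphere_compact Ssph)).
  exists (`|M| + 1) => [|x Sx]; first by rewrite ltr_wpDl.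
  by apply: MH; [rewrite (le_lt_trans (ler_norm _))// ltrDl|exists x].
have [G [HG cG _]] := continuous_bounded_extension (@pseudometric_normal R V)
  (is_sphere_closed Ssph) M0 cHg HM.
exists G => // x Sx; rewrite -HG ?inE//=.
by have := FH _ (gS _ Sx); rewrite /= gK ?inE.
Qed.

Definition separates (S A B : set V) : Prop :=
  [/\ open A, open B, A `&` B = set0 & ~` S = A `|` B].

Lemma separatesC S A B : separates S A B -> separates S B A.
Proof. by case=> oA oB AB SAB; split; rewrite 1?setIC 1?setUC. Qed.

(** On [A] the function [F] is replaced by a real lift of its restriction to [S]. Both agree
    modulo the integers on [S], the common boundary, so the result is continuous modulo the
    integers on the whole space even if [F] turns around something in [A]. *)
Lemma separated_extension (S A B : set V) (F : V -> R) :
  is_sphere S -> separates S A B -> zcont (~` A) F ->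
  exists2 H : V -> R, zcont setT H & forall x, B x -> H x = F x.
Proof.
move=> Ssph [oA oB AB SAB] cF.
have BA x : B x -> ~ A x by move=> Bx Ax; have : set0 x by rewrite -AB.
have SA x : S x -> ~ A x by move=> Sx Ax; have : (~` S) x by [rewrite SAB; left].
have SB x : S x -> ~ B x by move=> Sx Bx; have : (~` S) x by [rewrite SAB; right].
have ABS x : ~ A x -> ~ B x -> S x.
  by move=> nA nB; apply: contrapT => nS; have : (A `|` B) x by [rewrite -SAB]; case.
have cFS : zcont S F by exact: zcontW SA cF.
have [G cG FG] := topological_sphere_lift Ssph cFS.
pose H x := if `[< B x >] then F x else G x.
have HB x : B x -> H x = F x by move=> Bx; rewrite /H asboolT.
have HNB x : ~ B x -> H x = G x by move=> Bx; rewrite /H asboolF.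
exists H => //; apply: zcontT => p.
have cGp : zlim (nbhs p) G (G p) by apply: cvg_zlim; exact: cG.
have [Bp|nBp] := pselect (B p).
  rewrite (HB p Bp); have Bn : nbhs p B by exact: open_nbhs_nbhs.
  have Fp : zlim (nbhs p) F (F p).
    move=> e e0; have : \forall q \near nbhs p, ~ A q -> _ := cF p (BA _ Bp) e e0.
    by apply: filterS2 Bn => q Bq; apply; exact: BA.
  apply: zlim_near Fp; last by rewrite subrr; exact: is_integer0.
  by apply: filterS Bn => q Bq; rewrite HB// subrr; exact: is_integer0.
have [Ap|nAp] := pselect (A p).
  rewrite HNB//; have An : nbhs p A by exact: open_nbhs_nbhs.
  apply: zlim_near cGp; last by rewrite subrr; exact: is_integer0.
  apply: filterS An => q Aq; rewrite HNB ?subrr; first exact: is_integer0.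
  by move=> /BA.
(* At a point of S the values on B come from F and all others from G; the integer F p - G p
   reconciles them. *)
have Sp := ABS _ nAp nBp; rewrite HNB// => e e0.
have e20 : 0 < e / 2 by lra.
have : \forall q \near nbhs p, ~ A q -> _ := cF p nAp e e0.
have := cGp e e0; apply: filterS2 => q Gq Fq.
have [Bq|nBq] := pselect (B q); last by rewrite HNB.
have [k kZ Fqk] := Fq (BA _ Bq); exists (k + (F p - G p)).
  by apply: is_integerD => //; exact: FG.
by rewrite HB//; have -> : F q - G p - (k + (F p - G p)) = F q - F p - k by lra.
Qed.

Lemma cball_compact r : compact [set v : V | `|v| <= r].
Proof.
apply: bounded_closed_compact.
  exists r; split; first exact: num_real.
  by move=> M rM v /= vr; rewrite (le_trans vr)// ltW.
apply: (@closed_comp _ _ (fun v : V => `|v|)) (@closed_le _ r) => v _.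
exact: norm_continuous.
Qed.

(** The space has no loops to turn around: a ball is star-shaped. *)
Lemma separated_lift (S A B : set V) (F : V -> R) r :
  is_sphere S -> separates S A B -> zcont (~` A) F ->
  exists2 H : V -> R, {within [set v | `|v| <= r], continuous H} &
    forall x, B x -> `|x| <= r -> is_integer (F x - H x).
Proof.
move=> Ssph SAB cF; have [F' cF' F'F] := separated_extension Ssph SAB cF.
have [|t x||H cH FH] := @zcont_lift R V [set v | `|v| <= r] F'.
- exact: cball_compact.
- move=> /andP[t0 t1] /= xr; rewrite normrZ ger0_norm//.
  by rewrite (le_trans _ xr)// ler_piMl.
- exact: zcontW cF'.
by exists H => // x Bx xr; rewrite -F'F//; exact: FH.
Qed.

End Separation.

(** * A winding function around a family of strands *)

Section DiamondAngle.
Variable R : realType.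

(** The cosine of the direction of (u,v), for the norm |u|+|v| in place of the Euclidean one. *)
Definition diamond_cos (u v : R) : R := u / (`|u| + `|v|).

(** The angle of (u,v) as a fraction of a full turn, measured along the diamond |u|+|v| = 1.
    The cut is the half line of negative [u]. The value 1/4 at the origin makes the angles of
    (u,v) and (-u,v) add up to 1/2 modulo 1 everywhere. *)
Definition diamond_angle (u v : R) : R :=
  if 0 <= v then 4^-1 - diamond_cos u v / 4 else diamond_cos u v / 4 - 4^-1.

Lemma diamond_cos_sgM (e u v : R) : e ^+ 2 = 1 -> diamond_cos (e * u) v = e * diamond_cos u v.
Proof.
move=> e1; rewrite /diamond_cos normrM (_ : `|e| = 1) ?mul1r ?mulrA//.
by apply/eqP; rewrite -(@pexpr_eq1 _ _ 2)// real_normK ?num_real// e1.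
Qed.

Lemma diamond_cos0 (u : R) : diamond_cos u 0 = Num.sg u.
Proof.
rewrite /diamond_cos normr0 addr0; have [->|u0] := eqVneq u 0; first by rewrite mul0r sgr0.
by rewrite {1}[u]numEsg mulfK// normr_eq0.
Qed.

Lemma diamond_cos_cvg (T : Type) (W : set_system T) {FW : Filter W} (f g : T -> R) a b :
  (a != 0) || (b != 0) -> f @ W --> a -> g @ W --> b ->
  (fun t => diamond_cos (f t) (g t)) @ W --> diamond_cos a b.
Proof.
move=> ab0 fa gb; apply: cvgM => //; apply: cvgV.
  by rewrite paddr_eq0// !normr_eq0 negb_and.
by apply: cvgD; exact: cvg_norm.
Qed.

(** The two formulas agree modulo 1 where they meet: on the axis v = 0 the cosine is 1 or -1. *)
Lemma diamond_angle_zlim (T : Type) (W : set_system T) {FW : Filter W} (f g : T -> R) a b :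
  (a != 0) || (b != 0) -> f @ W --> a -> g @ W --> b ->
  zlim W (fun t => diamond_angle (f t) (g t)) (diamond_angle a b).
Proof.
move=> ab0 fa gb.
have cc : (fun t => diamond_cos (f t) (g t)) @ W --> diamond_cos a b.
  exact: diamond_cos_cvg.
have c1 : (fun t => 4^-1 - diamond_cos (f t) (g t) / 4) @ W --> 4^-1 - diamond_cos a b / 4.
  exact: (cvgB (cvg_cst _) (cvgM cc (cvg_cst _))).
have c2 : (fun t => diamond_cos (f t) (g t) / 4 - 4^-1) @ W --> diamond_cos a b / 4 - 4^-1.
  exact: (cvgB (cvgM cc (cvg_cst _)) (cvg_cst _)).
have [b0|b0|b0] := ltgtP b 0.
- apply: zlim_near (cvg_zlim c2); last first.
    by rewrite /diamond_angle leNgt b0 subrr; exact: is_integer0.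
  have : \forall t \near W, g t < 0 by exact: cvgr_lt gb _ b0.
  apply: filterS => t gt0.
  by rewrite /diamond_angle leNgt gt0 subrr; exact: is_integer0.
- apply: zlim_near (cvg_zlim c1); last first.
    by rewrite /diamond_angle ltW// subrr; exact: is_integer0.
  have : \forall t \near W, 0 < g t by exact: cvgr_gt gb _ b0.
  apply: filterS => t gt0.
  by rewrite /diamond_angle ltW// subrr; exact: is_integer0.
have a0 : a != 0 by move: ab0; rewrite b0 eqxx orbF.
move=> e e0.
have : \forall t \near W, `|diamond_cos a b - diamond_cos (f t) (g t)| < e.
  exact: cvgr_dist_lt cc _ e0.
apply: filterS => t.
rewrite /diamond_angle b0 lexx diamond_cos0.
case: (leP 0 (g t)) => gt0 ct.
  exists 0; first exact: is_integer0.
  have -> : 4^-1 - diamond_cos (f t) (g t) / 4 - (4^-1 - Num.sg a / 4) - 0 =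
    (Num.sg a - diamond_cos (f t) (g t)) / 4 by lra.
  rewrite normrM [`|4^-1|]gtr0_norm ?invr_gt0//.
  by rewrite (le_lt_trans _ ct)// ler_piMr//; lra.
exists (Num.sg a / 2 - 2^-1).
  by case: sgrP a0 => // _ _; [exists 0|exists (-1); rewrite mulrNz]; lra.
have -> : diamond_cos (f t) (g t) / 4 - 4^-1 - (4^-1 - Num.sg a / 4) - (Num.sg a / 2 - 2^-1) =
    - ((Num.sg a - diamond_cos (f t) (g t)) / 4) by lra.
rewrite normrN normrM [`|4^-1|]gtr0_norm ?invr_gt0//.
by rewrite (le_lt_trans _ ct)// ler_piMr//; lra.
Qed.

End DiamondAngle.

Section WindingFunction.
Variables (R : realType) (n : nat) (s : {perm 'I_n}).
Hypothesis s_nofix : forall i, s i != i.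
Local Notation V := 'rV[R]_3.
Local Notation pos := (@pos R n).
Implicit Types (i j : 'I_n) (v q : V).

(** Upwards and to the right, or downwards and to the left. Multiplication by [dir i] reduces
    the second case to the first. *)
Definition dir i : R := if (i < s i)%N then 1 else -1.

(** Positive inside the triangle with vertices (i,i), (i,s i) and (s i,s i), zero on its
    boundary and negative outside. *)
Definition depth i (v : V) : R :=
  Num.min (Num.min (dir i * (v ord0 0 - pos i)) (dir i * (pos (s i) - v ord0 1)))
    (dir i * (v ord0 1 - v ord0 0)).

Definition roof_arg i (v : V) : R :=
  (v ord0 1 - pos i) * (pos (s i) - v ord0 1) - n%:R ^+ 2 * `|v ord0 0 - pos i|.

(** A surface through the strand of [i] and through the chord of the diagonal that closes it
    up. The slope n^2 makes it so steep that it reaches height 0 before the next column. *)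
Definition roof i (v : V) : R := Num.max 0 (roof_arg i v).

Definition elevation i (v : V) : R := v ord0 2%:R - roof i v.

Definition spans i (t : R) : bool :=
  (0 < dir i * (t - pos i)) && (0 < dir i * (pos (s i) - t)).

(** The points of the chord, without its ends, which do lie on the strand. *)
Definition on_chord i (v : V) : bool :=
  [&& v ord0 0 == v ord0 1, v ord0 2%:R == 0 & spans i (v ord0 0)].

Definition strand i : set V :=
  at_height (vertical_height s i) @` vertical_edge s i
  `|` at_height (fun=> 0) @` horizontal_edge s i.

Lemma dir_sqr i : dir i ^+ 2 = 1.
Proof. by rewrite /dir; case: ifP; rewrite ?sqrrN expr1n. Qed.

Lemma pos_lt i j : (pos i < pos j) = (i < j)%N.
Proof. by rewrite /pos ltr_nat. Qed.

Lemma pos_inj : injective pos.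
Proof. by move=> i j /eqP; rewrite eqr_nat eqSS => /eqP/val_inj. Qed.

Lemma pos_dist i j : i != j -> 1 <= `|pos i - pos j|.
Proof.
rewrite /pos => ij; have [lt|lt|/val_inj/eqP] := ltngtP i j; last by rewrite (negPf ij).
- have : j.+1%:R >= i.+1%:R + 1 :> R by rewrite natr1 ler_nat.
  by move=> h; rewrite distrC ger0_norm; lra.
- have : i.+1%:R >= j.+1%:R + 1 :> R by rewrite natr1 ler_nat.
  by move=> h; rewrite ger0_norm; lra.
Qed.

Lemma pos_bound i : 1 <= pos i <= n%:R.
Proof. by rewrite /pos ler1n ler_nat /= ltn_ord. Qed.

Lemma dirP i : (dir i = 1 /\ pos i < pos (s i)) \/ (dir i = -1 /\ pos (s i) < pos i).
Proof.
rewrite /dir !pos_lt; case: ltngtP => h; [by left|by right|].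
by have := s_nofix i; rewrite -val_eqE /= h eqxx.
Qed.

Lemma dir_gt0 i : 0 < dir i * (pos (s i) - pos i).
Proof. by case: (dirP i) => -[-> h]; lra. Qed.

Lemma segmentP i t : segment (pos i) (pos (s i)) t <->
  0 <= dir i * (t - pos i) /\ 0 <= dir i * (pos (s i) - t).
Proof.
rewrite /segment /= ge_min le_max; case: (dirP i) => -[-> h]; split.
- by case/andP => /orP[?|?] /orP[?|?]; split; lra.
- by case=> h1 h2; apply/andP; split; apply/orP; [left|right]; lra.
- by case/andP => /orP[?|?] /orP[?|?]; split; lra.
- by case=> h1 h2; apply/andP; split; apply/orP; [right|left]; lra.
Qed.

Lemma depth_continuous i : continuous (depth i).
Proof.
apply: cts_min; first apply: cts_min; apply: cts_mul; try exact: cts_cst; apply: cts_add;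
  try exact: cts_cst; try exact: cts_coord; apply: cts_opp; try exact: cts_cst; exact: cts_coord.
Qed.

Lemma roof_arg_continuous i : continuous (roof_arg i).
Proof.
apply: cts_add.
  apply: cts_mul; apply: cts_add; try exact: cts_cst; try exact: cts_coord;
    apply: cts_opp; try exact: cts_cst; exact: cts_coord.
apply: cts_opp; apply: cts_mul; first exact: cts_cst.
by apply: cts_norm; apply: cts_add; [exact: cts_coord|exact: cts_cst].
Qed.

Lemma elevation_continuous i : continuous (elevation i).
Proof.
apply: cts_add; first exact: cts_coord.
by apply: cts_opp; apply: cts_max; [exact: cts_cst|exact: roof_arg_continuous].
Qed.

(** Near the inner points of the chord the roof is flat. Chords of different strands therefore
    coincide in space, as their cancellation requires. *)
Lemma roof_arg_lt0 i v : v ord0 0 = v ord0 1 -> spans i (v ord0 0) -> roof_arg i v < 0.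
Proof.
rewrite /roof_arg => <- /andP[]; move: (v ord0 0) => t.
have /andP[i1 i2] := pos_bound i; have /andP[si1 si2] := pos_bound (s i).
have n2 : n%:R <= n%:R ^+ 2 :> R by rewrite expr2 ler_peMl; lra.
case: (dirP i) => -[-> h] h1 h2; rewrite ?mul1r ?mulN1r in h1 h2.
  rewrite gtr0_norm// mulrC -mulrBl nmulr_rlt0//; lra.
by rewrite ltr0_norm ?mulrN ?opprK -?mulNr 1?mulrC; [rewrite -mulrDl|]; try nra.
Qed.

(** Where [depth] and [elevation] vanish the point is on the boundary of the lifted triangle,
    that is on one of the two edges of the strand or on the chord. *)
Lemma nonsingular i v : ~ strand i v -> ~~ on_chord i v ->
  (depth i v != 0) || (elevation i v != 0).
Proof.
rewrite -(point3_eta v); move: (v ord0 0) (v ord0 1) (v ord0 2%:R) => x y z.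
move=> nst nch; apply: contrapT => /negP; rewrite negb_or !negbK => /andP[/eqP d0 /eqP e0].
apply: nst; move: d0 e0 nch.
rewrite /depth /elevation /roof /roof_arg /on_chord !point3E => d0 e0 nch.
have [h1 h2 h3] :
    [/\ 0 <= dir i * (x - pos i), 0 <= dir i * (pos (s i) - y) & 0 <= dir i * (y - x)].
  have : 0 <= Num.min (Num.min (dir i * (x - pos i)) (dir i * (pos (s i) - y)))
    (dir i * (y - x)) by rewrite d0.
  by rewrite !le_min => /andP[/andP[]].
have {d0} : [\/ dir i * (x - pos i) = 0, dir i * (pos (s i) - y) = 0 | dir i * (y - x) = 0].
  by move: d0; rewrite /Num.min; case: ifP => _; [case: ifP => _|] => ->;
    [apply: Or31|apply: Or32|apply: Or33].
have dn0 : dir i != 0 by case: (dirP i) => -[-> _]; rewrite ?oppr_eq0 oner_eq0.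
have dir2 := dir_sqr i.
have yi : x = pos i -> strand i (point3 x y z).
  move=> xi; left; exists (pos i, y); first by exists y => //; apply/segmentP; rewrite -xi.
  have yy : 0 <= (y - pos i) * (pos (s i) - y).
    rewrite -[leRHS]mul1r -dir2 expr2 mulrACA mulr_ge0//.
    by rewrite -xi.
  rewrite /at_height /vertical_height /= xi; congr point3.
  by move: e0; rewrite xi subrr normr0 mulr0 subr0 max_r//; lra.
have xsi : y = pos (s i) -> strand i (point3 x y z).
  move=> ysi; right; exists (x, pos (s i)).
    by exists x => //; apply/segmentP; rewrite -ysi.
  rewrite /at_height /= ysi; congr point3.
  move: e0; rewrite ysi subrr mulr0 max_l; first lra.
  by rewrite sub0r oppr_le0 mulr_ge0// sqr_ge0.
case=> /eqP; rewrite mulf_eq0 (negPf dn0)/= subr_eq0 => /eqP.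
- exact: yi.
- by move=> /esym/xsi.
move=> yx; have [/yi//|nxi] := eqVneq x (pos i); have [/xsi//|nysi] := eqVneq y (pos (s i)).
have sp : spans i x.
  rewrite /spans !lt_def h1 -yx h2 !mulf_neq0// subr_eq0//; last by rewrite yx.
  by rewrite eq_sym.
exfalso; move/negP: nch; apply; rewrite yx eqxx sp andbT /=.
have := @roof_arg_lt0 i (point3 x x z); rewrite /roof_arg !point3E => /(_ erefl sp) lt0.
by move: e0; rewrite yx max_l ?ltW// subr0 => ->.
Qed.

(** Near a chord the pair ([depth], [elevation]) depends on [i] only through the sign [dir i]. *)
Lemma on_chord_near i v : on_chord i v -> \forall q \near nbhs v,
  depth i q = dir i * (q ord0 1 - q ord0 0) /\ elevation i q = q ord0 2%:R.
Proof.
case/and3P => /eqP xy /eqP z0 sp.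
have rn : \forall q \near nbhs v, roof_arg i q < 0.
  exact: cvgr_lt (@roof_arg_continuous i v) _ (roof_arg_lt0 xy sp).
have dl : 0 < Num.min (dir i * (v ord0 0 - pos i)) (dir i * (pos (s i) - v ord0 1))
     - dir i * (v ord0 1 - v ord0 0).
  by rewrite xy subrr mulr0 subr0 lt_min -[in X in _ && X]xy; move: sp; rewrite /spans xy.
pose gap (w : V) := Num.min (dir i * (w ord0 0 - pos i)) (dir i * (pos (s i) - w ord0 1))
     - dir i * (w ord0 1 - w ord0 0).
have cD : continuous gap.
  apply: cts_add; first apply: cts_min.
  - by apply: cts_mul; [exact: cts_cst|apply: cts_add; [exact: cts_coord|exact: cts_cst]].
  - apply: cts_mul; [exact: cts_cst|apply: cts_add; first exact: cts_cst].
    by apply: cts_opp; exact: cts_coord.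
  - apply: cts_opp; apply: cts_mul; first exact: cts_cst.
    by apply: cts_add; [exact: cts_coord|apply: cts_opp; exact: cts_coord].
have dn : \forall q \near nbhs v, 0 < gap q by exact: cvgr_gt (cD v) _ dl.
apply: filterS2 rn dn => q; rewrite subr_gt0 => rq dq; split.
  by rewrite /depth min_r// ltW.
by rewrite /elevation /roof max_l ?subr0// ltW.
Qed.

Definition vertex i : V := point3 (pos i) (pos i) 0.

Lemma strand_vertex i : strand i (vertex i).
Proof.
left; exists (pos i, pos i); first exists (pos i) => //.
  by apply/segmentP; rewrite subrr mulr0; split=> //; rewrite ltW// dir_gt0.
by rewrite /at_height /vertical_height /= subrr mul0r.
Qed.

Section Family.
Variable J : {set 'I_n}.
Hypothesis Jstable : forall i, (s i \in J) = (i \in J).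

Definition strands : set V := \bigcup_(i in [set i | i \in J]) strand i.

(** The cycles cross the level [t] as often upwards as downwards: the labels below [t] and the
    labels whose images are below [t] are equinumerous. *)
Lemma sum_dir_spans (t : R) : (forall i, i \in J -> t != pos i) ->
  \sum_(i in J | spans i t) dir i = 0.
Proof.
move=> tJ.
have -> : \sum_(i in J | spans i t) dir i =
    \sum_(i in J) ((pos i < t)%R%:R - (pos (s i) < t)%R%:R).
  rewrite big_mkcondr; apply: eq_bigr => i iJ; rewrite /spans.
  have ti : (t < pos i) = ~~ (pos i < t) by rewrite -leNgt le_eqVlt (negPf (tJ i iJ)).
  have tsi : (t < pos (s i)) = ~~ (pos (s i) < t).
    by rewrite -leNgt le_eqVlt (negPf (tJ (s i) _))// Jstable.
  case: (dirP i) => -[-> h]; rewrite ?mul1r ?mulN1r ?oppr_gt0 ?subr_gt0 ?subr_lt0 ?ti ?tsi.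
    have := @lt_trans _ _ (pos (s i)) (pos i) t h.
    by case: (pos i < t); case: (pos (s i) < t) => //= ab;
      rewrite ?subrr ?subr0//; have := ab isT.
  have := @lt_trans _ _ (pos i) (pos (s i)) t h.
  by case: (pos i < t); case: (pos (s i) < t) => //= ab;
    rewrite ?subrr ?sub0r//; have := ab isT.
rewrite sumrB; apply/eqP; rewrite subr_eq0; apply/eqP.
rewrite [LHS](reindex_inj (@perm_inj _ s)) /=.
by apply: eq_bigl => i; rewrite Jstable.
Qed.

Lemma sum_dir_on_chord v : ~ strands v -> \sum_(i in J | on_chord i v) dir i = 0.
Proof.
move=> vJ; have [/andP[/eqP xy /eqP z0]|nch] :=
  boolP ((v ord0 0 == v ord0 1) && (v ord0 2%:R == 0)); last first.
  rewrite big1// => i /andP[_ /and3P[h1 h2 _]].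
  by move: nch; rewrite h1 h2.
rewrite -[RHS](@sum_dir_spans (v ord0 0)).
  by apply: eq_bigl => i; rewrite /on_chord xy z0 !eqxx.
move=> i iJ; apply/eqP => xi; apply: vJ; exists i => //.
by rewrite -(point3_eta v) z0 -xy xi; exact: strand_vertex.
Qed.

(** Modulo the integers, the angle of a point around the strands of [J], in full turns. *)
Definition winding v : R := \sum_(i in J) diamond_angle (depth i v) (elevation i v).

(** Cosines need no choice of a branch, so this companion of [winding] is really continuous. *)
Definition balance v : R := \sum_(i in J) diamond_cos (depth i v) (elevation i v).

(** A point off the strands is on the chords of as many upward as downward ones. *)
Lemma integer_card_on_chord v : ~ strands v ->
  is_integer (\sum_(i in J | on_chord i v) 2^-1 : R).
Proof.
move=> vJ; have -> : \sum_(i in J | on_chord i v) 2^-1 =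
   \sum_(i in J | on_chord i v) ((1 + dir i) / 2) :> R.
  rewrite -[RHS]mulr_suml big_split /= sum_dir_on_chord// addr0 mulr_suml.
  by apply: eq_bigr => i _; rewrite mul1r.
apply: is_integer_sum => i _; case: (dirP i) => -[-> _]; [exists 1|exists 0]; lra.
Qed.

(** The only singular terms are those of chords through [v]; near [v] they are multiples of
    one common cosine by the signs [dir i], and these signs have sum 0. *)
Lemma balance_continuous_at v : ~ strands v -> {for v, continuous balance}.
Proof.
move=> vJ.
have split q : balance q = \sum_(i in J | on_chord i v) diamond_cos (depth i q) (elevation i q) +
    \sum_(i in J | ~~ on_chord i v) diamond_cos (depth i q) (elevation i q).
  by rewrite /balance (bigID (fun i => on_chord i v)).
have near0 : \forall q \near nbhs v,
    \sum_(i in J | on_chord i v) diamond_cos (depth i q) (elevation i q) = 0.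
  have : \forall q \near nbhs v, forall i, on_chord i v ->
      depth i q = dir i * (q ord0 1 - q ord0 0) /\ elevation i q = q ord0 2%:R.
    apply: filter_forall => i; have [/on_chord_near h|_] := boolP (on_chord i v).
      by apply: filterS h.
    exact: nearW.
  apply: filterS => q hq.
  under eq_bigr => i /andP[_ /hq[-> ->]] do rewrite (diamond_cos_sgM _ _ (dir_sqr i)).
  by rewrite -mulr_suml sum_dir_on_chord// mul0r.
pose g q := \sum_(i in J | ~~ on_chord i v) diamond_cos (depth i q) (elevation i q).
have bv : balance v = g v by rewrite split (nbhs_singleton near0) add0r.
rewrite /prop_for /continuous_at bv.
apply: (@cvg_trans _ (g @ v)).
  have bg : \forall q \near nbhs v, g q = balance q.
    by apply: filterS near0 => q; rewrite split => ->; rewrite add0r.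
  exact: near_eq_cvg bg.
apply: (@cvg_sumr R V (nbhs v) _ _ _ _ (fun i q => diamond_cos (depth i q) (elevation i q))).
move=> i /andP[iJ nch].
apply: diamond_cos_cvg; [|exact: depth_continuous|exact: elevation_continuous].
by apply: nonsingular nch => vi; apply: vJ; exists i.
Qed.

(** Near a point of a chord the singular terms are equal up to the reflection u -> -u, and the
    angles of reflected pairs have constant sum modulo 1. *)
Lemma winding_zlim v : ~ strands v -> zlim (nbhs v) winding (winding v).
Proof.
move=> vJ.
pose g q := \sum_(i in J | ~~ on_chord i v) diamond_angle (depth i q) (elevation i q).
pose h q := \sum_(i in J | on_chord i v) diamond_angle (depth i q) (elevation i q).
have split q : winding q = h q + g q.
  by rewrite /winding (bigID (fun i => on_chord i v)).
pose c : R := \sum_(i in J | on_chord i v) 4^-1.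
have near2 : \forall q \near nbhs v, is_integer (h q - c).
  have : \forall q \near nbhs v, forall i, on_chord i v ->
      depth i q = dir i * (q ord0 1 - q ord0 0) /\ elevation i q = q ord0 2%:R.
    apply: filter_forall => i; have [/on_chord_near hn|_] := boolP (on_chord i v).
      by apply: filterS hn.
    exact: nearW.
  apply: filterS => q hq; pose w := diamond_cos (q ord0 1 - q ord0 0) (q ord0 2%:R) / 4.
  pose e : R := if 0 <= q ord0 2%:R then 1 else -1.
  have -> : h q - c = \sum_(i in J | on_chord i v) ((e - 1) / 4 - e * w * dir i).
    rewrite -sumrB; apply: eq_bigr => i /andP[_ /hq[-> ->]].
    by rewrite /diamond_angle (diamond_cos_sgM _ _ (dir_sqr i)) /e /w; case: ifP => _; lra.
  rewrite sumrB -[X in _ - X]mulr_sumr sum_dir_on_chord// mulr0 subr0.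
  rewrite /e; case: ifP => _.
    by rewrite big1 => [|i _]; [exact: is_integer0|lra].
  rewrite (_ : \sum_(_ in _ | _) _ = - (\sum_(i in J | on_chord i v) 2^-1)).
    by apply: is_integerN; exact: integer_card_on_chord.
  by rewrite -sumrN; apply: eq_bigr => i _; lra.
apply: (@zlim_near _ _ _ _ _ (fun q => g q + c) _ (g v + c)).
- by apply: filterS near2 => q; rewrite split (_ : h q + g q - (g q + c) = h q - c)//; lra.
- rewrite split (_ : h v + g v - (g v + c) = h v - c); last lra.
  exact: nbhs_singleton near2.
apply: zlimD; last by apply: cvg_zlim; exact: cvg_cst.
apply: zlim_sum => i /andP[iJ nch].
apply: diamond_angle_zlim; [|exact: depth_continuous|exact: elevation_continuous].
by apply: nonsingular nch => vi; apply: vJ; exists i.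
Qed.

End Family.

End WindingFunction.

(** * Strands on opposite sides of a sphere do not cross *)

Section NoCrossing.
Variables (R : realType) (n : nat) (s : {perm 'I_n}).
Hypothesis s_nofix : forall i, s i != i.
Local Notation V := 'rV[R]_3.
Local Notation pos := (@pos R n).
Local Notation strand := (@strand R n s).
Local Notation dir := (@dir R n s).
Local Notation depth := (@depth R n s).
Local Notation roof := (@roof R n s).
Local Notation elevation := (@elevation R n s).
Local Notation spans := (@spans R n s).
Local Notation on_chord := (@on_chord R n s).
Local Notation winding := (@winding R n s).
Local Notation balance := (@balance R n s).
Local Notation strands := (@strands R n s).
Local Notation vertex := (@vertex R n).
Implicit Types (i j : 'I_n) (v q : V) (t : R).

Definition span_length j : R := pos (s j) - pos j.

Definition corner j : V := point3 (pos j) (pos (s j)) 0.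

Definition vertical_path j t : V :=
  point3 (pos j) (pos j + t * span_length j) (t * (1 - t) * span_length j ^+ 2).
Definition horizontal_path j t : V :=
  point3 (pos j + t * span_length j) (pos (s j)) 0.

Lemma vertical_path0 j : vertical_path j 0 = vertex j.
Proof. by rewrite /vertical_path !mul0r addr0. Qed.

Lemma vertical_path1 j : vertical_path j 1 = corner j.
Proof. by rewrite /vertical_path subrr mulr0 mul0r mul1r subrKC. Qed.

Lemma horizontal_path0 j : horizontal_path j 0 = corner j.
Proof. by rewrite /horizontal_path mul0r addr0. Qed.

Lemma horizontal_path1 j : horizontal_path j 1 = vertex (s j).
Proof. by rewrite /horizontal_path mul1r subrKC. Qed.

Lemma vertical_path_continuous j : continuous (vertical_path j).
Proof.
apply: point3_continuous; first exact: cts_cst.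
  by apply: cts_add; [exact: cts_cst|apply: cts_mul; [exact: cts_id|exact: cts_cst]].
apply: cts_mul; last exact: cts_cst.
apply: cts_mul; first exact: cts_id.
by apply: cts_add; [exact: cts_cst|apply: cts_opp; exact: cts_id].
Qed.

Lemma horizontal_path_continuous j : continuous (horizontal_path j).
Proof.
apply: point3_continuous; try exact: cts_cst.
by apply: cts_add; [exact: cts_cst|apply: cts_mul; [exact: cts_id|exact: cts_cst]].
Qed.

Lemma segment_path j t : 0 <= t <= 1 ->
  segment (pos j) (pos (s j)) (pos j + t * span_length j).
Proof.
move=> /andP[t0 t1]; apply/(segmentP s_nofix).
have := @dir_gt0 R n s s_nofix j; rewrite -/(span_length j) => d0.
have -> : dir j * (pos j + t * span_length j - pos j) = t * (dir j * span_length j) by ring.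
have -> : dir j * (pos (s j) - (pos j + t * span_length j)) = (1 - t) * (dir j * span_length j).
  by rewrite /span_length; ring.
by split; apply: mulr_ge0 (ltW d0); lra.
Qed.

Lemma strand_vertical_path j t : 0 <= t <= 1 -> strand j (vertical_path j t).
Proof.
move=> t01; left; exists (pos j, pos j + t * span_length j).
  by exists (pos j + t * span_length j) => //; exact: segment_path.
by rewrite /at_height /vertical_height /=; congr point3; rewrite /span_length; ring.
Qed.

Lemma strand_horizontal_path j t : 0 <= t <= 1 -> strand j (horizontal_path j t).
Proof.
move=> t01; right; exists (pos j + t * span_length j, pos (s j)) => //.
by exists (pos j + t * span_length j) => //; exact: segment_path.
Qed.

Lemma span_length_bound j : span_length j ^+ 2 <= n%:R ^+ 2.
Proof.
have := pos_bound R j; have := pos_bound R (s j); rewrite /span_length => h1 h2.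
by rewrite -ler_sqrt ?sqr_ge0// !sqrtr_sqr ler_norml [`|n%:R|]ger0_norm//; lra.
Qed.

Lemma path_coord_bound j t : 0 <= t <= 1 -> `|pos j + t * span_length j| <= n%:R.
Proof.
move=> /andP[t0 t1]; have := pos_bound R j; have := pos_bound R (s j).
rewrite /span_length => /andP[h1 h2] /andP[h3 h4].
have -> : pos j + t * (pos (s j) - pos j) = (1 - t) * pos j + t * pos (s j) by ring.
have u0 : 0 <= 1 - t by lra.
rewrite ger0_norm; last by apply: addr_ge0; apply: mulr_ge0 => //; lra.
have -> : n%:R = (1 - t) * n%:R + t * n%:R :> R by ring.
by apply: lerD; apply: ler_wpM2l.
Qed.

Definition diagram_radius : R := n%:R ^+ 2 + n%:R.

Lemma vertical_path_bound j t : 0 <= t <= 1 -> `|vertical_path j t| <= diagram_radius.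
Proof.
move=> t01; have nn := sqr_ge0 (n%:R : R); have n0 : 0 <= n%:R :> R by [].
rewrite /diagram_radius; apply: norm3_le; first lra.
apply: ord3P; rewrite point3E.
- have /andP[h1 h2] := pos_bound R j; rewrite ger0_norm; lra.
- by apply: (le_trans (path_coord_bound j t01)); lra.
- have w2 := sqr_ge0 (span_length j); have wn := span_length_bound j.
  have /andP[h0 h1] := t01.
  rewrite ger0_norm; last by apply: mulr_ge0 => //; apply: mulr_ge0; lra.
  have : t * (1 - t) * span_length j ^+ 2 <= 1 * span_length j ^+ 2.
    by apply: ler_wpM2r => //; nra.
  lra.
Qed.

Lemma horizontal_path_bound j t : 0 <= t <= 1 -> `|horizontal_path j t| <= diagram_radius.
Proof.
move=> t01; have nn := sqr_ge0 (n%:R : R); have n0 : 0 <= n%:R :> R by [].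
rewrite /diagram_radius; apply: norm3_le; first lra.
apply: ord3P; rewrite point3E.
- by apply: (le_trans (path_coord_bound j t01)); lra.
- have /andP[h1 h2] := pos_bound R (s j); rewrite ger0_norm; lra.
- rewrite normr0; lra.
Qed.

(** Over the columns of the other labels the roof of [i] is flat. *)
Lemma roof_eq0 i v : 1 <= `|v ord0 0 - pos i| -> roof i v = 0.
Proof.
move=> vi; rewrite /roof /roof_arg; apply/max_l; rewrite subr_le0.
have := span_length_bound i; rewrite /span_length.
move: (v ord0 1) (pos i) (pos (s i)) vi => y a b vi ab.
have h : (y - a) * (b - y) <= (b - a) ^+ 2.
  have := sqr_ge0 (b - a); have := sqr_ge0 (y - a); have := sqr_ge0 (b - y); lra.
apply: (le_trans h); apply: (le_trans ab).
by rewrite ler_peMr// sqr_ge0.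
Qed.

Section Family.
Variable J : {set 'I_n}.
Hypothesis Jstable : forall i, (s i \in J) = (i \in J).

Lemma memJ_neq i j : i \in J -> j \notin J -> j != i.
Proof. by move=> iJ jJ; apply: contraNneq jJ => ->. Qed.

(** A vertical edge of another strand rises from height 0, where the roofs of all other labels
    lie over its column. *)
Lemma winding_vertical j t : j \notin J -> 0 <= t <= 1 ->
  winding J (vertical_path j t) =
  \sum_(i in J) 4^-1 - 4^-1 * balance J (vertical_path j t).
Proof.
move=> jJ /andP[t0 t1]; rewrite /winding /balance mulr_sumr -sumrB.
apply: eq_bigr => i iJ; rewrite /diamond_angle /elevation roof_eq0; last first.
  by rewrite point3E; apply: pos_dist; exact: memJ_neq.
rewrite subr0 point3E ifT; first lra.
by apply: mulr_ge0; [apply: mulr_ge0; lra|exact: sqr_ge0].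
Qed.

(** A horizontal edge of another strand stays at height 0, under the roofs. The branch of the
    angle valid there differs from the actual one by an integer off the chords and by 1/2 on
    them, and the number of chords through a point is even. *)
Lemma winding_horizontal j t : ~ strands J (horizontal_path j t) ->
  is_integer (winding J (horizontal_path j t)
    - (4^-1 * balance J (horizontal_path j t) - \sum_(i in J) 4^-1)).
Proof.
set v := horizontal_path j t => vJ.
rewrite /winding /balance mulr_sumr -!sumrB (bigID (fun i => on_chord i v)) /=.
apply: is_integerD.
  rewrite (eq_bigr (fun=> 2^-1)); first exact: integer_card_on_chord.
  move=> i /andP[iJ ch]; have [dE eE] := nbhs_singleton (on_chord_near s_nofix ch).
  case/and3P: ch => /eqP xy /eqP z0 _.
  rewrite dE eE xy z0 subrr mulr0 /diamond_angle lexx diamond_cos0 sgr0; lra.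
apply: is_integer_sum => i /andP[iJ nch].
have nsing : (depth i v != 0) || (elevation i v != 0).
  by apply: nonsingular nch => // vi; apply: vJ; exists i.
have e0 : elevation i v <= 0.
  by rewrite /elevation point3E sub0r oppr_le0 le_max lexx.
rewrite /diamond_angle; case: (leP 0 (elevation i v)) => [e0'|_]; last first.
  by exists 0; lra.
have eE : elevation i v = 0 by apply/eqP; rewrite eq_le e0.
move: nsing; rewrite eE eqxx orbF diamond_cos0 => d0.
by case: sgrP d0 => // _ _; [exists 0|exists 1]; lra.
Qed.

(** The corner (j,s j) of the strand of [j] is inside the triangle of [i]. *)
Definition contains_corner i j : bool :=
  [&& 0 < dir i * (pos j - pos i), 0 < dir i * (pos (s i) - pos (s j))
    & 0 < dir i * (pos (s j) - pos j)].

Lemma balance_vertex j : j \notin J ->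
  balance J (vertex j) = \sum_(i in J) ((spans i (pos j))%:R - 1).
Proof.
move=> jJ; rewrite /balance; apply: eq_bigr => i iJ.
have ij := memJ_neq iJ jJ.
have sij : j != s i by apply: memJ_neq jJ; rewrite Jstable.
rewrite /elevation roof_eq0; last by rewrite point3E; exact: pos_dist.
rewrite point3E subr0 diamond_cos0 /depth !point3E subrr mulr0 /spans.
have d0 : dir i != 0 by case: (dirP R s_nofix i) => -[-> _]; rewrite ?oppr_eq0 oner_eq0.
have h1 : dir i * (pos j - pos i) != 0.
  by rewrite mulf_neq0// subr_eq0 (inj_eq (@pos_inj R n)).
have h2 : dir i * (pos (s i) - pos j) != 0.
  by rewrite mulf_neq0// subr_eq0 (inj_eq (@pos_inj R n)) eq_sym.
move: h1 h2; move: (dir i * _) (dir i * _) => b a a0 b0.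
have [pa|na|ea] := ltgtP 0 a; last by rewrite -ea eqxx in a0.
  have [pb|nb|eb] := ltgtP 0 b; last by rewrite -eb eqxx in b0.
    by rewrite min_r ?sgr0 ?subrr// le_min !ltW.
  by rewrite sub0r (min_r (ltW (lt_trans nb pa))) min_l ?ltW// ltr0_sg.
rewrite sub0r ltr0_sg//; by rewrite !gt_min na.
Qed.

Lemma balance_corner j : j \notin J ->
  balance J (corner j) = \sum_(i in J) (2 * (contains_corner i j)%:R - 1).
Proof.
move=> jJ; rewrite /balance; apply: eq_bigr => i iJ.
have ij := memJ_neq iJ jJ.
have sij : s j != s i by rewrite (inj_eq (@perm_inj _ s)).
rewrite /elevation roof_eq0; last by rewrite point3E; exact: pos_dist.
rewrite point3E subr0 diamond_cos0 /depth !point3E /contains_corner.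
have d0 : dir i != 0 by case: (dirP R s_nofix i) => -[-> _]; rewrite ?oppr_eq0 oner_eq0.
have h1 : dir i * (pos j - pos i) != 0.
  by rewrite mulf_neq0// subr_eq0 (inj_eq (@pos_inj R n)).
have h2 : dir i * (pos (s i) - pos (s j)) != 0.
  by rewrite mulf_neq0// subr_eq0 (inj_eq (@pos_inj R n)) eq_sym.
have h3 : dir i * (pos (s j) - pos j) != 0.
  by rewrite mulf_neq0// subr_eq0 (inj_eq (@pos_inj R n)).
move: h1 h2 h3; move: (dir i * _) (dir i * _) (dir i * _) => c b a a0 b0 c0.
have mE : [&& 0 < a, 0 < b & 0 < c] = (0 < Num.min (Num.min a b) c).
  by rewrite !lt_min andbA.
have m0 : Num.min (Num.min a b) c != 0.
  by rewrite /Num.min; case: ifP => _ //; case: ifP.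
rewrite mE; case: sgrP m0 => // _ _ /=; lra.
Qed.

(** Half of the strands over a generic level go in any given direction. *)
Lemma sum_spans j (e : R) : j \notin J -> e ^+ 2 = 1 ->
  \sum_(i in J) (spans i (pos j))%:R =
  2 * \sum_(i in J) (spans i (pos j) && (dir i == e))%:R :> R.
Proof.
move=> jJ e1.
have := @sum_dir_spans R n s s_nofix J Jstable (pos j) _.
have tJ i : i \in J -> pos j != pos i.
  by move=> iJ; rewrite (inj_eq (@pos_inj R n)); exact: memJ_neq.
move=> /(_ tJ); rewrite big_mkcondr /= => sum0.
rewrite -[LHS]addr0 -[X in _ + X](mulr0 e) -[X in _ + e * X]sum0 !mulr_sumr.
rewrite -big_split /=; apply: eq_bigr => i _.
case: (spans i _) => /=; last by rewrite !mulr0 addr0.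
have [->|ne] := eqVneq (dir i) e; first by rewrite -expr2 e1 /=; lra.
have : (dir i - e) * (dir i + e) = 0.
  by rewrite -subr_sqr dir_sqr e1 subrr.
move/eqP; rewrite mulf_eq0 subr_eq0 (negPf ne)/= => /eqP de.
have -> : dir i = - e by lra.
by rewrite mulrN -expr2 e1 /=; lra.
Qed.

(** A triangle whose interior contains the corner of [j] is on the same side of the diagonal
    and reaches beyond the end of the horizontal edge. *)
Lemma contains_corner_spans i j : contains_corner i j -> spans i (pos (s j)) && (dir i == dir j).
Proof.
case/and3P => h1 h2 h3; rewrite /spans h2 andbT.
have -> : dir i * (pos (s j) - pos i) =
  dir i * (pos (s j) - pos j) + dir i * (pos j - pos i) by ring.
rewrite addr_gt0//=.
move: h3; case: (dirP R s_nofix i) => -[-> _];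
  case: (dirP R s_nofix j) => -[-> h]; rewrite ?eqxx//; lra.
Qed.

(** The terms of the sum count the strands [i] that go in the direction of [j] and span the
    level s j, but start only beyond the column of [j]: these cross over the horizontal edge
    of [j]. *)
Lemma balance_drop j : j \notin J ->
  balance J (vertex (s j)) - balance J (corner j) =
  2 * \sum_(i in J) ((spans i (pos (s j)) && (dir i == dir j))%:R - (contains_corner i j)%:R).
Proof.
move=> jJ; have sjJ : s j \notin J by rewrite Jstable.
rewrite balance_vertex// balance_corner// !sumrB (sum_spans sjJ (@dir_sqr R n s j)).
by rewrite -mulr_sumr; ring.
Qed.

Section Separated.
Variables S A B : set V.
Hypothesis Ssph : is_sphere S.
Hypothesis SAB : separates S A B.
Hypothesis JA : forall i, i \in J -> strand i `<=` A.
Hypothesis JB : forall j, j \notin J -> strand j `<=` B.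

Lemma avoids_strands v : B v -> ~ strands J v.
Proof.
move=> Bv [i /= iJ vi]; case: SAB => _ _ AB _.
by have : set0 v by rewrite -AB; split => //; exact: JA vi.
Qed.

Lemma winding_zcont : zcont (~` A) (winding J).
Proof.
move=> v Av; apply: (@zlim_le _ _ _ (nbhs v)); last first.
  apply: winding_zlim => // -[i /= iJ vi]; apply: Av; exact: JA vi.
by move=> D; rewrite /within /=; apply: filterS => q.
Qed.

(** Along [p] the lift [H] differs from [e] times [balance] by a constant up to integers,
    hence by a constant. *)
Lemma path_conserved (H : V -> R) (r e c : R) (p : R -> V) :
  {within [set v | `|v| <= r], continuous H} ->
  (forall v, B v -> `|v| <= r -> is_integer (winding J v - H v)) ->
  continuous p -> (forall t, 0 <= t <= 1 -> B (p t) /\ `|p t| <= r) ->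
  (forall t, 0 <= t <= 1 -> is_integer (winding J (p t) - (e * balance J (p t) + c))) ->
  H (p 1) - e * balance J (p 1) = H (p 0) - e * balance J (p 0).
Proof.
move=> cH HZ cp pB pZ.
have fZ t : 0 <= t <= 1 -> is_integer (H (p t) - e * balance J (p t) - c).
  move=> t01; have [Bt rt] := pB t t01.
  have -> : H (p t) - e * balance J (p t) - c =
    (winding J (p t) - (e * balance J (p t) + c)) - (winding J (p t) - H (p t)) by lra.
  by apply: is_integerB; [exact: pZ|exact: HZ].
apply: (@integer_path_const _ (fun t => H (p t) - e * balance J (p t)) 0 1) => //.
  have cHp : {within `[0, 1], continuous (H \o p)}.
    apply: (continuous_within_comp (f := p) (B := [set v | `|v| <= r]) _ _ cH).
      by move=> t /=; rewrite in_itv /= => /pB[].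
    exact: continuous_subspaceT.
  apply/subspace_continuousP => t t01; apply: cvgB.
    by move/subspace_continuousP : cHp; exact.
  apply: cvgM; first exact: cvg_cst.
  apply: cvg_within_filter; apply: (@continuous_comp _ _ _ p (balance J)); first exact: cp.
  apply: balance_continuous_at => //; apply: avoids_strands.
  by move: t01; rewrite /= in_itv /= => /pB[].
move=> t t01.
have -> : H (p t) - e * balance J (p t) - (H (p 0) - e * balance J (p 0)) =
  (H (p t) - e * balance J (p t) - c) - (H (p 0) - e * balance J (p 0) - c) by lra.
by apply: is_integerB; apply: fZ => //; lra.
Qed.

(** Along the strand of [j] the function [4 * H] increases by the drop of [balance] on the
    vertical edge and by its growth on the horizontal one. Since [s] permutes the labels
    outside [J], the values at the vertices cancel in the sum over them. *)
Lemma sum_balance_drop :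
  \sum_(j | j \notin J) (balance J (vertex (s j)) - balance J (corner j)) = 0.
Proof.
have [H cH HZ] := separated_lift diagram_radius Ssph SAB winding_zcont.
have stepE j : j \notin J -> 2 * (balance J (vertex (s j)) - balance J (corner j)) =
    (4 * H (vertex (s j)) + balance J (vertex (s j))) - (4 * H (vertex j) + balance J (vertex j)).
  move=> jJ.
  have vE := @path_conserved H diagram_radius (- 4^-1) (\sum_(i in J) 4^-1)
    (vertical_path j) cH HZ (@vertical_path_continuous j).
  have hE := @path_conserved H diagram_radius 4^-1 (- \sum_(i in J) 4^-1)
    (horizontal_path j) cH HZ (@horizontal_path_continuous j).
  rewrite vertical_path0 vertical_path1 in vE.
  rewrite horizontal_path0 horizontal_path1 in hE.
  suff : H (corner j) - - 4^-1 * balance J (corner j) =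
         H (vertex j) - - 4^-1 * balance J (vertex j) /\
         H (vertex (s j)) - 4^-1 * balance J (vertex (s j)) =
         H (corner j) - 4^-1 * balance J (corner j) by case; lra.
  split; [apply: vE|apply: hE] => t t01.
  - by split; [apply: JB jJ _ _; exact: strand_vertical_path|exact: vertical_path_bound].
  - rewrite winding_vertical//; exists 0; lra.
  - by split; [apply: JB jJ _ _; exact: strand_horizontal_path|exact: horizontal_path_bound].
  - apply: winding_horizontal; apply: avoids_strands; apply: JB jJ _ _.
    exact: strand_horizontal_path.
apply: (@mulfI _ 2) => //; rewrite mulr0 mulr_sumr (eq_bigr _ stepE) sumrB.
apply/eqP; rewrite subr_eq0; apply/eqP.
rewrite [RHS](reindex_inj (@perm_inj _ s)) /=.
by apply: eq_bigl => j; rewrite Jstable.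
Qed.

(** The drops are nonnegative by [contains_corner_spans], and a crossing makes one of them
    positive. *)
Lemma no_crossing i j : i \in J -> j \notin J -> dir i = dir j ->
  0 < dir j * (pos i - pos j) -> 0 < dir j * (pos (s j) - pos i) ->
  0 < dir j * (pos (s i) - pos (s j)) -> False.
Proof.
move=> iJ jJ dij h1 h2 h3.
have term_ge0 k l :
    0 <= (spans k (pos (s l)) && (dir k == dir l))%:R - (contains_corner k l)%:R :> R.
  by rewrite subr_ge0; case: (boolP (contains_corner k l)) => [/contains_corner_spans ->|_].
have drop0 : balance J (vertex (s j)) - balance J (corner j) = 0.
  apply: (psumr_eq0P _ sum_balance_drop) => // k kJ.
  by rewrite balance_drop// mulr_ge0// sumr_ge0.
move: drop0; rewrite balance_drop// => /eqP; rewrite mulf_eq0 pnatr_eq0 /= => /eqP drop0.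
have := psumr_eq0P (fun k _ => term_ge0 k j) drop0 iJ.
have -> : contains_corner i j = false.
  by rewrite /contains_corner dij; apply: contra_ltF h1 => /and3P[h _ _]; lra.
rewrite /spans dij eqxx h3 andbT.
have -> : 0 < dir j * (pos (s j) - pos i) by [].
by rewrite /= subr0 => /eqP; rewrite oner_eq0.
Qed.

End Separated.
End Family.
End NoCrossing.

(** * Permutations without crossings *)

Section Combinatorics.
Variables (n : nat) (s : {perm 'I_n}).

(** The vertical edge of [i] passes over the horizontal edge of [j] above the diagonal, or
    below it. *)
Definition crosses_over (i j : 'I_n) : bool :=
  (j < i < s j)%N && (s j < s i)%N || (s i < s j)%N && (s j < i < j)%N.

(** The interval goes from the least label [a] in [J] to the first [b] over which no strand of
    [J] passes upwards. Every level in between is covered by strands of [J] in both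
    directions, so a strand outside [J] that leaves the interval would have to cross over one
    of them. *)
Lemma noncrossing_stabilized_interval (J : {set 'I_n}) (z : 'I_n) :
  (forall i, (s i \in J) = (i \in J)) ->
  J != finset.set0 -> z \notin J -> (forall i, (z <= i)%N) ->
  (forall i j, i \notin J -> j \in J -> ~~ crosses_over i j) ->
  exists I : {set 'I_n}, [/\ Defs.is_interval I, I != finset.set0,
    I \proper [set: 'I_n]%SET & stabilizes s I].
Proof.
move=> Jst /finset.set0Pn[x0 x0J] zJ zmin ncr.
case: (arg_minnP (fun i : 'I_n => nat_of_ord i) x0J) => a aJ amin'.
have amin (j : 'I_n) : j \in J -> (a <= j)%N := @amin' j.
pose closed_at b := (a <= b)%N && [forall x in J, (x <= b)%N ==> (s x <= b)%N].
have exb : exists b, closed_at b.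
  exists n; rewrite /closed_at (ltnW (ltn_ord a)); apply/forall_inP => x _.
  by rewrite (ltnW (ltn_ord (s x))) implybT.
case: (ex_minnP exb) => b /andP[ab /forall_inP bcl] bmin.
have nclosed p : (a <= p < b)%N -> exists2 x, x \in J & (x <= p < s x)%N.
  move=> /andP[ap pb]; have : ~~ closed_at p by apply/negP => /bmin; rewrite leqNgt pb.
  rewrite /closed_at ap /= negb_forall_in => /exists_inP[x xJ].
  by rewrite negb_imply -ltnNge => ?; exists x.
exists [set i : 'I_n | (a <= i <= b)%N]%SET; split.
- by exists a, b.
- by apply/finset.set0Pn; exists a; rewrite inE leqnn.
- rewrite finset.properEneq finset.subsetT andbT; apply/eqP => /finset.setP/(_ z).
  rewrite !inE => /andP[az _]; move/negP: zJ; apply.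
  by have -> : z = a by apply: val_inj; apply/eqP; rewrite eqn_leq az zmin.
move=> p; rewrite !inE => /andP[ap pb].
have [pJ|pJ] := boolP (p \in J).
  by apply/andP; split; [apply: amin; rewrite Jst|exact: implyP (bcl p pJ) pb].
have JneP x : x \in J -> (x : nat) != p by move=> xJ; apply: contraNneq pJ => /val_inj <-.
have {ap} ap : (a < p)%N by rewrite ltn_neqAle JneP.
(* A strand of J going down over p, resp. up over p - 1, is crossed by a strand from p that
   leaves the interval downwards, resp. upwards. *)
apply/andP; split; rewrite leqNgt; apply/negP => sp.
  have {pb} pb : (p < b)%N.
    rewrite ltn_neqAle pb andbT; apply/eqP => pb'.
    have [|x xJ /andP[xp spx]] := nclosed p.-1; first by lia.
    have := implyP (bcl x xJ); have := JneP (s x); rewrite Jst => /(_ xJ); lia.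
  have [|x xJ /andP[xp spx]] := nclosed p; first by lia.
  (* Some strand of J goes up over p, so another one comes back down. *)
  have [y yJ /andP[py syp]] : exists2 y, y \in J & (p < y)%N && (s y <= p)%N.
    apply/exists_inP; apply: contraLR spx; rewrite negb_exists_in => /forall_inP up.
    pose D := [set y in J | (p < y)%N]%SET.
    have sD : (s @: D)%SET = D.
      apply/eqP; rewrite eqEcard card_imset ?leqnn ?andbT; last exact: perm_inj.
      apply/fintype.subsetP => _ /imsetP[y + ->]; rewrite !inE Jst => /andP[yJ py].
      by have := up y yJ; rewrite yJ py /= -ltnNge.
    apply/negP => spx; have : s x \in D by rewrite inE Jst xJ.
    rewrite -sD => /imsetP[y + /perm_inj xy]; rewrite -xy inE => /andP[_]; lia.
  have := ncr p y pJ yJ; apply/negP/negPn; rewrite /crosses_over.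
  have := JneP (s y); rewrite Jst => /(_ yJ) ne; have := amin (s y); rewrite Jst => /(_ yJ) asy.
  by apply/orP; right; lia.
have [|x xJ /andP[xp spx]] := nclosed p.-1; first by lia.
have := ncr p x pJ xJ; apply/negP/negPn; rewrite /crosses_over.
have := JneP (s x); rewrite Jst => /(_ xJ) ne; have := implyP (bcl x xJ) => h.
by apply/orP; left; lia.
Qed.

End Combinatorics.

(** * The surface of a box as a sphere *)

Section Paths.
Variable R : realType.
Local Notation V := 'rV[R]_3.

Lemma path_component (X : set V) (p : R -> V) a b : a <= b -> continuous p ->
  (forall t, a <= t <= b -> X (p t)) -> connected_component X (p a) (p b).
Proof.
move=> ab cp pX; apply: (@connected_component_max _ X (p @` `[a, b]) (p a)).
- by exists a => //=; rewrite in_itv /= lexx.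
- by move=> _ [t /= tab <-]; apply: pX; move: tab; rewrite in_itv.
- apply: connected_continuous_connected; first exact: segment_connected.
  exact: continuous_subspaceT.
- by exists b => //=; rewrite in_itv /= lexx ab.
Qed.

Lemma component_mono (X Y : set V) x : X `<=` Y ->
  connected_component X x `<=` connected_component Y x.
Proof.
move=> XY y Xxy; have Xx : X x.
  by apply: contrapT => /connected_component_out X0; rewrite X0 in Xxy.
apply: (@connected_component_max _ Y (connected_component X x) x) Xxy.
- exact: connected_component_refl.
- by apply: subset_trans XY; exact: connected_component_sub.
- exact: component_connected.
Qed.

End Paths.

Section Box.
Variables (R : realType) (c w h : R).
Hypotheses (w_ge : 2^-1 <= w) (h_ge : 2^-1 <= h).
Local Notation V := 'rV[R]_3.

Definition to_box (y : V) : V :=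
  point3 (c + w * y ord0 0) (c + w * y ord0 1) (h * y ord0 2%:R).
Definition from_box (x : V) : V :=
  point3 (w^-1 * (x ord0 0 - c)) (w^-1 * (x ord0 1 - c)) (h^-1 * x ord0 2%:R).

(** The norm is the maximum norm, so its unit sphere is the surface of a cube. *)
Definition box_gauge (x : V) : R := `|from_box x|.
Definition box_surface : set V := [set x | box_gauge x = 1].

Let w_neq0 : w != 0. Proof. by apply: lt0r_neq0; apply: lt_le_trans w_ge; rewrite invr_gt0. Qed.
Let h_neq0 : h != 0. Proof. by apply: lt0r_neq0; apply: lt_le_trans h_ge; rewrite invr_gt0. Qed.

Lemma to_boxK : cancel to_box from_box.
Proof.
move=> y; rewrite -[RHS]point3_eta /from_box !point3E.
by congr point3; rewrite ?(addrC c) ?addrK mulKf.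
Qed.

Lemma from_boxK : cancel from_box to_box.
Proof.
move=> x; rewrite -[RHS]point3_eta /to_box !point3E.
by congr point3; rewrite mulVKf// subrKC.
Qed.

Lemma to_box_continuous : continuous to_box.
Proof.
by apply: point3_continuous; [apply: cts_add; [exact: cts_cst|]|apply: cts_add; [exact: cts_cst|]|];
  apply: cts_mul; [exact: cts_cst|exact: cts_coord|exact: cts_cst|exact: cts_coord|exact: cts_cst|
  exact: cts_coord].
Qed.

Lemma from_box_continuous : continuous from_box.
Proof.
apply: point3_continuous; apply: cts_mul; try exact: cts_cst; try exact: cts_coord;
  by apply: cts_add; [exact: cts_coord|exact: cts_cst].
Qed.

Lemma norm3_continuous : continuous (fun y : V => `|y|).
Proof. by move=> y; exact: norm_continuous. Qed.

Lemma box_gauge_continuous : continuous box_gauge.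
Proof.
by move=> x; apply: (@continuous_comp _ _ _ from_box (fun y : V => `|y|));
  [exact: from_box_continuous|exact: norm3_continuous].
Qed.

Lemma scale_inv_continuous_at (nu : V -> R) (y : V) : continuous nu -> nu y != 0 ->
  {for y, continuous (fun u : V => (nu u)^-1 *: u)}.
Proof.
move=> cnu nuy.
have -> : (fun u : V => (nu u)^-1 *: u) = fun u => point3 ((nu u)^-1 * u ord0 0)
    ((nu u)^-1 * u ord0 1) ((nu u)^-1 * u ord0 2%:R).
  by apply/funext => u; apply/rowP; apply: ord3P; rewrite point3E !mxE.
have cq k : (fun u : V => (nu u)^-1 * u ord0 k) @ y --> (nu y)^-1 * y ord0 k.
  apply: (@cvgM _ V (nbhs y)); last exact: cts_coord.
  by apply: (@cvgV _ V (nbhs y)) => //; exact: cnu.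
by apply: (@point3_cvg R V (nbhs y)); exact: cq.
Qed.

Definition euclidean (y : V) : R := Num.sqrt (\sum_k y ord0 k ^+ 2).

Lemma euclidean_continuous : continuous euclidean.
Proof. exact: (cts_sqrt (@sumsq_continuous R)). Qed.

Lemma euclidean_gt0 y : y != 0 -> 0 < euclidean y.
Proof.
move=> y0; rewrite sqrtr_gt0 lt_def sumr_ge0 ?andbT; last by move=> k _; exact: sqr_ge0.
apply: contra_neq y0 => /psumr_eq0P y0; apply/rowP => k; rewrite mxE; apply/eqP.
by rewrite -sqrf_eq0; apply/eqP/y0 => // i _; exact: sqr_ge0.
Qed.

Lemma euclideanZ a y : 0 <= a -> euclidean (a *: y) = a * euclidean y.
Proof.
move=> a0; rewrite /euclidean (eq_bigr (fun k => a ^+ 2 * y ord0 k ^+ 2)).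
  by rewrite -mulr_sumr sqrtrM ?sqr_ge0// sqrtr_sqr ger0_norm.
by move=> k _; rewrite mxE exprMn.
Qed.

Lemma unit_sphereE (y : V) : unit_sphere y <-> euclidean y = 1.
Proof.
rewrite /unit_sphere /euclidean /=; split=> [->|y1]; first exact: sqrtr1.
rewrite -(expr1n _ 2) -y1 sqr_sqrtr//.
by apply: sumr_ge0 => k _; exact: sqr_ge0.
Qed.

(** Radial projection from the centre of the box. *)
Lemma box_surface_sphere : is_sphere box_surface.
Proof.
pose f (y : V) := to_box (`|y|^-1 *: y).
pose g (x : V) := (euclidean (from_box x))^-1 *: from_box x.
have sph0 (y : V) : unit_sphere y -> y != 0.
  move/unit_sphereE => y1; apply: contra_eq_neq y1 => ->.
  by rewrite -[0](scale0r 0) euclideanZ// mul0r eq_sym oner_eq0.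
have box0 x : box_surface x -> from_box x != 0.
  by rewrite /box_surface /box_gauge /= => x1; rewrite -normr_eq0 x1 oner_eq0.
exists f, g; split.
- move=> y /sph0 y0; rewrite /box_surface /box_gauge /= to_boxK normrZ.
  by rewrite ger0_norm ?invr_ge0// mulVf// normr_eq0.
- move=> x /box0 x0; apply/unit_sphereE.
  by rewrite /g euclideanZ ?invr_ge0 ?ltW ?euclidean_gt0// mulVf// gt_eqF// euclidean_gt0.
- move=> y; rewrite inE => y1; have y0 := sph0 _ y1; rewrite /g to_boxK.
  rewrite euclideanZ ?invr_ge0// (unit_sphereE y).1// mulr1 invrK scalerA.
  by rewrite divff ?scale1r// normr_eq0.
- move=> x; rewrite inE => x1; have x0 := box0 _ x1; rewrite /f -[RHS]from_boxK; congr to_box.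
  rewrite /g normrZ gtr0_norm ?invr_gt0 ?euclidean_gt0//.
  move: x1; rewrite /box_surface /box_gauge /= => ->; rewrite mulr1 invrK scalerA.
  by rewrite divff ?scale1r// gt_eqF// euclidean_gt0.
split.
  apply: continuous_in_subspaceT => y; rewrite inE => /sph0 y0.
  apply: (@continuous_comp _ _ _ (fun u : V => `|u|^-1 *: u) to_box).
    by apply: scale_inv_continuous_at; [exact: norm3_continuous|rewrite normr_eq0].
  exact: to_box_continuous.
apply: continuous_in_subspaceT => x; rewrite inE => /box0 x0.
apply: (@continuous_comp _ _ _ from_box (fun u : V => (euclidean u)^-1 *: u)).
  exact: from_box_continuous.
apply: scale_inv_continuous_at; first exact: euclidean_continuous.
by rewrite gt_eqF// euclidean_gt0.
Qed.

Lemma component_inside x : box_gauge x < 1 ->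
  connected_component (~` box_surface) x `<=` [set y | box_gauge y < 1].
Proof.
move=> x1 y xy /=; rewrite ltNge; apply/negP => y1.
have /connected_intervalP ci : connected (box_gauge @` connected_component (~` box_surface) x).
  apply: connected_continuous_connected; first exact: component_connected.
  exact/continuous_subspaceT/box_gauge_continuous.
have nx : (~` box_surface) x by move=> x1'; move: x1; rewrite x1' ltxx.
have [|||z /connected_component_sub nz z1] := ci (box_gauge x) (box_gauge y) _ _ 1.
- by exists x => //; exact: connected_component_refl.
- by exists y.
- by rewrite ltW.
exact: nz.
Qed.

Lemma box_inside_bounded : bounded_set [set y | box_gauge y < 1].
Proof.
have hw := w_ge; have hh := h_ge.
exists (`|c| + w + h); split; first exact: num_real.
move=> M hM y /= y1.
have c0 := normr_ge0 c.
rewrite -(from_boxK y) (le_trans _ (ltW hM))//.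
have coord k : `|from_box y ord0 k| <= 1 by rewrite (le_trans (coord_le_norm _ _))// ltW.
have w0 : `|w| = w by rewrite ger0_norm//; lra.
have h0 : `|h| = h by rewrite ger0_norm//; lra.
have wle k : `|w * from_box y ord0 k| <= w by rewrite normrM w0 ler_piMr//; lra.
apply: norm3_le; first lra.
apply: ord3P; rewrite point3E.
- by rewrite (le_trans (ler_normD _ _))//; have := wle 0; lra.
- by rewrite (le_trans (ler_normD _ _))//; have := wle 1; lra.
- have : `|h * from_box y ord0 2%:R| <= h by rewrite normrM h0 ler_piMr//; lra.
  lra.
Qed.

Lemma box_interior x : box_gauge x < 1 -> sphere_interior box_surface x.
Proof.
move=> x1; split; first by move=> x1'; move: x1; rewrite x1' ltxx.
have [M [Mr bM]] := box_inside_bounded; exists M; split => // M' MM' y.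
by move=> /(component_inside x1); exact: bM.
Qed.

(** The ray from the centre of the box through [x] leaves every ball without meeting the
    surface again. *)
Lemma box_exterior x : 1 < box_gauge x -> sphere_exterior box_surface x.
Proof.
move=> x1; split; first by move=> x1'; move: x1; rewrite x1' ltxx.
have hw := w_ge; have hh := h_ge; move=> [M [Mr bM]].
pose p (t : R) := to_box (t *: from_box x).
(* On the ball of radius |M| + 1 the gauge is at most b - 1, because 1/w and 1/h are at most 2. *)
pose b := 2 * (`|M| + 1 + `|c|) + 1.
have b1 : 1 <= b by have := normr_ge0 M; have := normr_ge0 c; rewrite /b; lra.
have cp : continuous p.
  move=> t; apply: (@continuous_comp _ _ _ (fun t : R => t *: from_box x) to_box).
    exact: scalel_continuous.
  exact: to_box_continuous.
have gp t : 1 <= t -> box_gauge (p t) = t * box_gauge x.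
  by move=> t1; rewrite /box_gauge to_boxK normrZ ger0_norm//; lra.
have pX t : 1 <= t <= b -> (~` box_surface) (p t).
  by move=> /andP[t1 _]; rewrite /box_surface /= gp// => tx; nra.
have := path_component b1 cp pX; rewrite {1}/p scale1r from_boxK.
have M1 : M < `|M| + 1 by rewrite (le_lt_trans (ler_norm _))// ltrDl.
move/(bM _ M1) => pb; have := gp b b1; have : b * 1 < b * box_gauge x by rewrite ltr_pM2l//; lra.
move=> /[swap] <-; apply/negP; rewrite -leNgt mulr1.
have c0 := normr_ge0 c; have M0 := normr_ge0 M.
have winv : `|w^-1| <= 2.
  by rewrite ger0_norm ?invr_ge0; [rewrite -[2]invrK lef_pV2 ?posrE|]; lra.
have hinv : `|h^-1| <= 2.
  by rewrite ger0_norm ?invr_ge0; [rewrite -[2]invrK lef_pV2 ?posrE|]; lra.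
have cb k : `|p b ord0 k| <= `|M| + 1 by rewrite (le_trans (coord_le_norm _ _)).
have wb k : `|w^-1 * (p b ord0 k - c)| <= 2 * (`|M| + 1 + `|c|).
  by rewrite normrM ler_pM// (le_trans (ler_normB _ _))// lerD2r.
rewrite /box_gauge /b; apply: norm3_le; first lra.
apply: ord3P; rewrite point3E.
- by have := wb 0; lra.
- by have := wb 1; lra.
- have : `|h^-1 * p b ord0 2%:R| <= 2 * (`|M| + 1) by rewrite normrM ler_pM.
  lra.
Qed.

Lemma box_splits (L : set V) :
  (forall v, L v -> box_gauge v != 1) ->
  (exists2 v, L v & box_gauge v < 1) -> (exists2 v, L v & 1 < box_gauge v) ->
  split_link L.
Proof.
move=> L1 [x Lx x1] [y Ly y1]; exists box_surface.
have LS : L `<=` ~` box_surface by move=> v /L1/eqP.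
split.
- exact: box_surface_sphere.
- by apply/seteqP; split=> // v [Sv /LS].
- exists (connected_component L x); first by exists x.
  by move=> q /(component_mono LS) /(component_inside x1); exact: box_interior.
exists (connected_component L y); first by exists y.
move=> q Lq; have Sq := component_mono LS Lq.
have [_ yext] := box_exterior y1.
split; first by apply: LS; apply: connected_component_sub Lq.
by rewrite -(same_connected_component Sq).
Qed.

End Box.

(** * Splitting the link of a permutation *)

Section Link.
Variables (R : realType) (n : nat) (s : {perm 'I_n}).
Local Notation V := 'rV[R]_3.
Local Notation pos := (@pos R n).
Local Notation strand := (@strand R n s).
Local Notation vertex := (@vertex R n).
Local Notation L := (permutation_link R s).
Implicit Types (i j k : 'I_n) (v : V).

Definition circle k : set V := at_height (fun=> 0) @` fixpoint_square k.

Lemma permutation_linkP v : L v <->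
  exists k, (s k != k /\ strand k v) \/ (s k = k /\ circle k v).
Proof.
split.
  case=> -[k /= sk kv]; exists k; [by left|by right].
by move=> [k [[sk kv]|[sk kv]]]; [left|right]; exists k.
Qed.

Lemma permutation_link_piece k : exists2 v, L v &
  (s k != k /\ strand k v) \/ (s k = k /\ circle k v).
Proof.
have [sk|sk] := eqVneq (s k) k.
  have cv : circle k (point3 (pos k + 4^-1) (pos k) 0).
    exists (pos k + 4^-1, pos k) => //; rewrite /fixpoint_square /=.
    by rewrite addrC addKr subrr normr0 max_l// ger0_norm// invr_ge0.
  by exists (point3 (pos k + 4^-1) (pos k) 0); [apply/permutation_linkP; exists k|]; right.
have sv : strand k (vertex k).
  left; exists (pos k, pos k).
    by exists (pos k) => //; rewrite /segment /= ge_min le_max lexx.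
  by rewrite /at_height /vertical_height /= subrr mul0r.
by exists (vertex k); [apply/permutation_linkP; exists k|]; left.
Qed.

Lemma strand_bounds k v lo hi : strand k v ->
  lo <= pos k <= hi -> lo <= pos (s k) <= hi ->
  [/\ lo <= v ord0 0 <= hi, lo <= v ord0 1 <= hi & 0 <= v ord0 2%:R <= n%:R ^+ 2].
Proof.
move=> kv kb skb; have nn : 0 <= n%:R ^+ 2 :> R by exact: sqr_ge0.
have seg t : segment (pos k) (pos (s k)) t -> lo <= t <= hi.
  by rewrite /segment /= ge_min le_max => /andP[/orP[?|?] /orP[?|?]]; lra.
case: kv => -[_ [t tb <-] <-]; rewrite /at_height !point3E /=; have tlh := seg t tb.
  split => //; rewrite /vertical_height /=.
  have := span_length_bound R s k; rewrite /span_length.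
  move: tb; rewrite /segment /= ge_min le_max.
  move: (pos k) (pos (s k)) => a b.
  have sq := sqr_ge0 (b - a); have sq1 := sqr_ge0 (t - a); have sq2 := sqr_ge0 (b - t).
  move=> tb ab; apply/andP; split; last lra.
  case/andP: tb => /orP[h1|h1] /orP[h2|h2].
  - have -> : t = a by lra.
    by rewrite subrr mul0r.
  - by apply: mulr_ge0; lra.
  - by rewrite -mulrNN; apply: mulr_ge0; lra.
  - have -> : t = b by lra.
    by rewrite subrr mulr0.
by split => //; rewrite lexx nn.
Qed.

Lemma strand_coord k v : strand k v -> v ord0 0 = pos k \/ v ord0 1 = pos (s k).
Proof. by case=> -[_ [t _ <-] <-]; rewrite /at_height !point3E; [left|right]. Qed.

Lemma circle_bounds k v : circle k v ->
  [/\ `|v ord0 0 - pos k| <= 4^-1, `|v ord0 1 - pos k| <= 4^-1 & v ord0 2%:R = 0].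
Proof.
move=> [q]; rewrite /fixpoint_square /= => qk <-; rewrite /at_height !point3E.
by rewrite -qk !le_max !lexx orbT.
Qed.

(** The square over the interval is enlarged by 1/2 on each side, between the quarter taken by
    the circles of fixed points and the distance 1 to the next row or column. Strands reach at
    most height n^2. *)
Lemma stabilized_interval_split (I : {set 'I_n}) : Defs.is_interval I ->
  I != finset.set0 -> I \proper [set: 'I_n]%SET -> stabilizes s I -> split_link L.
Proof.
move=> [a [b IE]] /finset.set0Pn[i0 i0I] /properP[_ [j0 _ j0I]] Ist.
have Iab k : (k \in I) = (a <= k <= b)%N by rewrite IE inE.
have sI k : (s k \in I) = (k \in I).
  apply/idP/idP => [skI|]; last exact: Ist.
  have sIE : (s @: I)%SET = I.
    apply/eqP; rewrite eqEcard card_imset ?leqnn ?andbT; last exact: perm_inj.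
    by apply/fintype.subsetP => _ /imsetP[x xI ->]; exact: Ist.
  by move: skI; rewrite -{1}sIE => /imsetP[x xI /perm_inj ->].
pose c : R := (a%:R + b%:R) / 2 + 1; pose w : R := (b%:R - a%:R) / 2 + 2^-1.
pose h : R := n%:R ^+ 2 + 1.
have nn : 0 <= n%:R ^+ 2 :> R by exact: sqr_ge0.
have ab : a%:R <= b%:R :> R.
  by rewrite ler_nat; move: i0I; rewrite Iab => /andP[]; exact: leq_trans.
have w2 : 2^-1 <= w by rewrite /w; lra.
have h2 : 2^-1 <= h by rewrite /h; lra.
have w0 : 0 < w by lra.
have h0 : 0 < h by lra.
have posI k : k \in I -> a%:R + 1 <= pos k <= b%:R + 1.
  by rewrite Iab /pos !natr1 !ler_nat !ltnS.
have posNI k : k \notin I -> pos k <= a%:R \/ b%:R + 2 <= pos k.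
  rewrite Iab negb_and -!ltnNge /pos -natrD !ler_nat addn2 !ltnS.
  by case/orP; [left|right].
have inside k v : k \in I -> (s k != k /\ strand k v) \/ (s k = k /\ circle k v) ->
    box_gauge c w h v < 1.
  move=> kI kv.
  have [v0 v1 v2] : [/\ `|v ord0 0 - c| < w, `|v ord0 1 - c| < w & `|v ord0 2%:R| < h].
    have kb := posI k kI; case: kv => [[_ kv]|[_ kv]].
      have skb : a%:R + 1 <= pos (s k) <= b%:R + 1 by apply: posI; rewrite sI.
      have [v0 v1 v2] := strand_bounds kv kb skb.
      by split; rewrite ltr_norml /c /w /h; lra.
    have [] := circle_bounds kv; rewrite !ler_norml => v0 v1 ->.
    by split; rewrite ltr_norml /c /w /h; lra.
  apply: norm3_lt => //; apply: ord3P; rewrite point3E normrM ger0_norm ?invr_ge0 ?ltW//;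
    by rewrite mulrC ltr_pdivrMr ?mul1r.
have outside k v : k \notin I -> (s k != k /\ strand k v) \/ (s k = k /\ circle k v) ->
    1 < box_gauge c w h v.
  move=> kI kv.
  have far : w < `|v ord0 0 - c| \/ w < `|v ord0 1 - c|.
    case: kv => [[_ /strand_coord[]]|[_ /circle_bounds[]]].
    - move=> ->; left; rewrite ltr_normr /c /w.
      by have [?|?] := posNI k kI; apply/orP; [right|left]; lra.
    - move=> ->; right; rewrite ltr_normr /c /w.
      have skI : s k \notin I by rewrite sI.
      by have [?|?] := posNI _ skI; apply/orP; [right|left]; lra.
    - rewrite ler_norml => v0 _ _; left; rewrite ltr_normr /c /w.
      by have [?|?] := posNI k kI; apply/orP; [right|left]; lra.
  case: far => far; [apply: lt_le_trans (coord_le_norm _ 0)|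
    apply: lt_le_trans (coord_le_norm _ 1)];
    by rewrite point3E normrM ger0_norm ?invr_ge0 ?ltW// mulrC ltr_pdivlMr ?mul1r.
apply: (@box_splits _ c w h w2 h2).
- move=> v /permutation_linkP[k kv].
  have [kI|kI] := boolP (k \in I); first by rewrite (lt_eqF (inside k v kI kv)).
  by rewrite (gt_eqF (outside k v kI kv)).
- have [v Lv kv] := permutation_link_piece i0; exists v => //; exact: inside i0I kv.
- have [v Lv kv] := permutation_link_piece j0; exists v => //; exact: outside j0I kv.
Qed.

Section Sides.
Variable S : set V.
Hypothesis Ssph : is_sphere S.

(** The complement of a sphere is open and balls are connected by segments. *)
Lemma component_near x : ~ S x -> \forall y \near nbhs x, connected_component (~` S) x y.
Proof.
move=> Sx; have oS : open (~` S) by apply: closed_openC; exact: is_sphere_closed.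
have /nbhs_ballP[e /= e0 eS] : nbhs x (~` S) by exact: open_nbhs_nbhs.
apply/nbhs_ballP; exists e => //= y xy.
pose p (t : R) := x + t *: (y - x).
have := @path_component R (~` S) p 0 1 _ _ _.
rewrite /p scale0r addr0 scale1r subrKC; apply => //.
  by move=> t; apply: cvgD; [exact: cvg_cst|exact: scalel_continuous].
move=> t /andP[t0 t1]; apply: eS; move: xy; rewrite -!ball_normE /=.
rewrite opprD addrA subrr sub0r normrN normrZ ger0_norm// distrC => xy.
by rewrite (le_lt_trans _ xy)// ler_piMl.
Qed.

Lemma interior_component x y : connected_component (~` S) x y ->
  sphere_interior S x -> sphere_interior S y.
Proof.
move=> xy [_ bx]; split; first exact: connected_component_sub xy.
by rewrite -(same_connected_component xy).
Qed.

Lemma exterior_component x y : connected_component (~` S) x y ->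
  sphere_exterior S x -> sphere_exterior S y.
Proof.
move=> xy [_ bx]; split; first exact: connected_component_sub xy.
by rewrite -(same_connected_component xy).
Qed.

Lemma separates_interior : separates S (sphere_interior S) (sphere_exterior S).
Proof.
split.
- rewrite openE => x xi; have := component_near xi.1.
  by apply: filterS => y xy; exact: interior_component xy xi.
- rewrite openE => x xi; have := component_near xi.1.
  by apply: filterS => y xy; exact: exterior_component xy xi.
- by apply/seteqP; split => // x [[_ bx] [_ ]].
apply/seteqP; split => [x Sx|x [[]|[]]//].
by case: (pselect (bounded_set (connected_component (~` S) x))) => h; [left|right].
Qed.

End Sides.

Section NonSplit.
Hypothesis s_nofix : forall i, s i != i.

(** Each point of a strand is reached from its vertex along the vertical edge, and then
    possibly along the horizontal one. *)
Lemma strand_component (X : set V) k v : strand k `<=` X -> strand k v ->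
  connected_component X (vertex k) v.
Proof.
move=> kX kv; pose w : R := span_length R s k.
have w0 : w != 0.
  by rewrite /w /span_length subr_eq0 (inj_eq (@pos_inj R n)).
have param t : segment (pos k) (pos (s k)) t -> exists2 u, 0 <= u <= 1 & t = pos k + u * w.
  move=> /(segmentP s_nofix)[h1 h2]; exists ((t - pos k) / w); last first.
    by rewrite divfK// subrKC.
  move: h1 h2 w0; rewrite /w /span_length.
  case: (dirP R s_nofix k) => -[-> lt] h1 h2 w0.
    by rewrite divr_ge0 ?ler_pdivrMr; lra.
  by rewrite -mulrNN -invrN divr_ge0 ?ler_pdivrMr; lra.
have vert u : 0 <= u <= 1 -> connected_component X (vertex k) (@vertical_path R n s k u).
  move=> /andP[u0 u1]; rewrite -(@vertical_path0 R n s k); apply: path_component => //.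
    exact: vertical_path_continuous.
  by move=> t tu; apply: kX; apply: strand_vertical_path => //; lra.
case: kv => -[_ [t /param[u u01 ->] <-] <-].
  rewrite (_ : at_height _ _ = @vertical_path R n s k u); first exact: vert.
  rewrite /at_height /vertical_height /=; congr point3.
  by rewrite /w /span_length; ring.
apply: (connected_component_trans (y := @corner R n s k)).
  by rewrite -(@vertical_path1 R n s k); apply: vert; lra.
rewrite (_ : at_height _ _ = @horizontal_path R n s k u) // -(@horizontal_path0 R n s k).
have /andP[u0 u1] := u01.
apply: path_component => //; first exact: horizontal_path_continuous.
by move=> t' tu; apply: kX; apply: strand_horizontal_path => //; lra.
Qed.

Lemma strand_next_vertex k : strand k (vertex (s k)).
Proof. by rewrite -(@horizontal_path1 R n s k); apply: strand_horizontal_path => //; lra. Qed.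

Lemma strand_sub_link k : strand k `<=` L.
Proof. by move=> v kv; apply/permutation_linkP; exists k; left. Qed.

Lemma not_crosses_over (S A B : set V) (J : {set 'I_n}) i j :
  is_sphere S -> separates S A B -> (forall k, (s k \in J) = (k \in J)) ->
  (forall k, k \in J -> strand k `<=` A) -> (forall k, k \notin J -> strand k `<=` B) ->
  i \in J -> j \notin J -> ~~ crosses_over s i j.
Proof.
move=> Ssph SAB Jst JA JB iJ jJ; apply/negP => cr.
have noc := no_crossing s_nofix Jst Ssph SAB JA JB iJ jJ.
have dE k : dir R s k = if (k < s k)%N then 1 else -1 by [].
case/orP: cr => /andP[]; first move=> /andP[ji isj] sjsi.
  have ij : dir R s i = 1 by rewrite dE (ltn_trans isj).
  have jj : dir R s j = 1 by rewrite dE (ltn_trans ji).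
  by apply: noc; rewrite ?ij ?jj // mul1r subr_gt0 pos_lt.
move=> sisj /andP[sji ij].
have di : dir R s i = -1 by rewrite dE ltnNge ltnW// (ltn_trans sisj).
have dj : dir R s j = -1 by rewrite dE ltnNge ltnW// (ltn_trans sji).
by apply: noc; rewrite ?di ?dj // mulN1r oppr_gt0 subr_lt0 pos_lt.
Qed.

Lemma split_stabilized_interval : split_link L ->
  exists I : {set 'I_n}, [/\ Defs.is_interval I, I != finset.set0,
    I \proper [set: 'I_n]%SET & stabilizes s I].
Proof.
move=> [S [Ssph SL [K [x Lx KE] Kin] [K' [x' Lx' K'E] K'ex]]].
have LS : L `<=` ~` S by move=> v Lv Sv; have : set0 v by rewrite -SL.
have SAB := separates_interior Ssph.
have [_ _ AB _] := SAB.
have strS k : strand k `<=` ~` S by move=> v /strand_sub_link/LS.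
have [J JP] : exists J : {set 'I_n}, forall k, k \in J <-> sphere_interior S (vertex k).
  exists [set k | `[< sphere_interior S (vertex k) >]]%SET => k.
  by rewrite inE; split=> /asboolP.
have toV k v : strand k v -> connected_component (~` S) (vertex k) v.
  by apply: strand_component; exact: strS.
have JA k : k \in J -> strand k `<=` sphere_interior S.
  by move=> /JP kin v /toV kv; exact: interior_component kv kin.
have JB k : k \notin J -> strand k `<=` sphere_exterior S.
  move=> kJ v /toV kv; apply: (exterior_component kv).
  have : (~` S) (vertex k) by apply: (strS k); exact: strand_vertex.
  by case: SAB => _ _ _ -> -[/JP kJ'|//]; rewrite kJ' in kJ.
have Jst k : (s k \in J) = (k \in J).
  have kk := toV _ _ (strand_next_vertex k).
  apply/idP/idP => /JP h; apply/JP.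
    exact: interior_component (connected_component_sym kk) h.
  exact: interior_component kk h.
have findk v : L v -> exists k, strand k v.
  move=> /permutation_linkP[k [[_ kv]|[sk _]]]; first by exists k.
  by have := s_nofix k; rewrite sk eqxx.
have [k kx] := findk x Lx; have [k' kx'] := findk x' Lx'.
have xin : sphere_interior S x by apply: Kin; rewrite KE; exact: connected_component_refl.
have x'ex : sphere_exterior S x'.
  by apply: K'ex; rewrite K'E; exact: connected_component_refl.
have kJ : k \in J by apply/JP; exact: interior_component (connected_component_sym (toV _ _ kx)) xin.
have k'J : k' \notin J.
  apply/negP => /JA/(_ _ kx') x'in; have : set0 x' by rewrite -AB.
  by [].
have n0 : (0 < n)%N by exact: leq_ltn_trans (ltn_ord k).
pose z := Ordinal n0; have zmin i : (z <= i)%N by [].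
have Cst i : (s i \in (~: J)%SET) = (i \in (~: J)%SET) by rewrite !inE Jst.
(* The roles of J and its complement are exchanged if J contains the first label, since the
   interval spanned by J must be proper. *)
have [zJ|zJ] := boolP (z \in J).
  apply: (@noncrossing_stabilized_interval _ s (~: J)%SET z) => //.
  - by apply/finset.set0Pn; exists k'; rewrite inE.
  - by rewrite inE zJ.
  move=> i j; rewrite !inE negbK => iJ jJ.
  exact: not_crosses_over Ssph SAB Jst JA JB iJ jJ.
apply: (@noncrossing_stabilized_interval _ s J z) => //.
  by apply/finset.set0Pn; exists k.
move=> i j iJ jJ; apply: (@not_crosses_over S _ _ (~: J)%SET) (separatesC SAB) Cst _ _ _ _ => //.
- by move=> l; rewrite inE => /JB.
- by move=> l; rewrite inE negbK => /JA.
- by rewrite inE.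
- by rewrite inE negbK.
Qed.

End NonSplit.

(** Every point of the square is reached from a corner along at most two sides. *)
Lemma circle_connected (X : set V) k v : circle k `<=` X -> circle k v ->
  connected_component X (point3 (pos k + 4^-1) (pos k + 4^-1) 0) v.
Proof.
pose pt (a b : R) : V := point3 (pos k + a) (pos k + b) 0.
move=> kX [[x y]]; rewrite /fixpoint_square /at_height /= => ab <-.
have -> : point3 x y 0 = pt (x - pos k) (y - pos k) by rewrite /pt !subrKC.
move: (x - pos k) (y - pos k) ab => a b ab.
have ptX a' b' : Num.max `|a'| `|b'| = 4^-1 -> X (pt a' b').
  move=> ab'; apply: kX; exists (pos k + a', pos k + b') => //.
  by rewrite /fixpoint_square /= !(addrC (pos k)) !addrK.
have [a1 a2] : `|a| <= 4^-1 /\ `|b| <= 4^-1 by rewrite -ab !le_max !lexx orbT.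
have q0 : `|4^-1| = 4^-1 :> R by rewrite ger0_norm// invr_ge0.
have leq u : `|u| <= 4^-1 -> u <= 4^-1 :> R by rewrite ler_norml => /andP[].
have up u t : `|u| <= 4^-1 -> u <= t <= 4^-1 -> `|t| <= 4^-1 :> R.
  by rewrite !ler_norml; lra.
have movex e u : `|e| = 4^-1 -> `|u| <= 4^-1 -> connected_component X (pt u e) (pt 4^-1 e).
  move=> eE uu; apply: (@path_component _ X (fun t => pt t e) u 4^-1); first exact: leq.
    apply: point3_continuous; try exact: cts_cst.
    by apply: cts_add; [exact: cts_cst|exact: cts_id].
  by move=> t /(up _ _ uu) tt; apply: ptX; rewrite eE max_r.
have movey e u : `|e| = 4^-1 -> `|u| <= 4^-1 -> connected_component X (pt e u) (pt e 4^-1).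
  move=> eE uu; apply: (@path_component _ X (fun t => pt e t) u 4^-1); first exact: leq.
    apply: point3_continuous; try exact: cts_cst.
    by apply: cts_add; [exact: cts_cst|exact: cts_id].
  by move=> t /(up _ _ uu) tt; apply: ptX; rewrite eE max_l.
apply: connected_component_sym.
have : `|a| = 4^-1 \/ `|b| = 4^-1 by move: ab; rewrite /Num.max; case: ifP; [right|left].
case=> e.
  apply: (connected_component_trans (y := pt a 4^-1)); first exact: movey.
  by apply: movex => //; rewrite q0.
apply: (connected_component_trans (y := pt 4^-1 b)); first exact: movex.
by apply: movey => //; rewrite q0.
Qed.

(** With a single label the link is one circle, which cannot have components on two sides. *)
Lemma unknot_nonsplit k : (forall i, i = k) -> ~ split_link L.
Proof.
move=> allk [S [Ssph SL [K [x Lx KE] Kin] [K' [x' Lx' K'E] K'ex]]].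
have ck v : L v <-> circle k v.
  split=> [/permutation_linkP[i]|kv].
    by rewrite (allk i) (allk (s k)) eqxx => -[[]|[]].
  by apply/permutation_linkP; exists k; right; split=> //; exact: allk.
have kL : circle k `<=` L by move=> v /ck.
have xx' : connected_component L x x'.
  apply: (connected_component_trans (y := point3 (pos k + 4^-1) (pos k + 4^-1) 0)).
    by apply: connected_component_sym; apply: circle_connected => //; apply/ck.
  by apply: circle_connected => //; apply/ck.
have [_ bx] : sphere_interior S x' by apply: Kin; rewrite KE.
by have [_] : sphere_exterior S x' by
  apply: K'ex; rewrite K'E; exact: connected_component_refl.
Qed.

End Link.

Theorem theorem1p4 (R : realType) (n : nat) (n_gt0 : (0 < n)%N)
    (s : {perm 'I_n}) :
  nonsplit_link (permutation_link R s) <-> stabilized_interval_free s.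
Proof.
split=> [nsp I Iint I0 IT Ist|sif].
  by apply: nsp; exact: stabilized_interval_split Iint I0 IT Ist.
have [[k /eqP sk]|nofix] := pselect (exists k, s k == k); last first.
  have s_nofix i : s i != i by apply/negP => si; apply: nofix; exists i.
  move=> /(split_stabilized_interval s_nofix)[I [Iint I0 IT Ist]].
  exact: sif Iint I0 IT Ist.
have kint : Defs.is_interval [set k]%SET.
  by exists k, k; apply/setP => i; rewrite !inE -eqn_leq eq_sym.
have kst : stabilizes s [set k]%SET by move=> i; rewrite !inE => /eqP ->; rewrite sk.
apply: (@unknot_nonsplit _ _ _ k) => i; apply/eqP; apply: contrapT => /negP ik.
apply: (sif _ kint) kst; first by apply/finset.set0Pn; exists k; rewrite inE.
rewrite finset.properEneq finset.subsetT andbT; apply/eqP => /finset.setP/(_ i).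
by rewrite !inE (negPf ik).
Qed.
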